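(* The marginal forward process with density path $p_t(x)=\int_{\mathbb{R}^d}p_t(x\mid x_0)p_0(x_0)\,\mathrm{d}x_0$ is generated by the SDE $$\mathrm{d}X_t=f_tX_t\,\mathrm{d}t+g_t\,\mathrm{d}W_t,\qquad X_0\sim p_0.$$ Equivalently, for all $t\in(0,1)$ and $x\in\mathbb{R}^d$, the marginal density path satisfies the Fokker--Planck equation $$\partial_tp_t(x)=-\nabla\cdot\bigl(f_tx\,p_t(x)\bigr)+\tfrac12g_t^2\,\Delta p_t(x).$$
   Context: $X_0\in\mathbb{R}^d$ is a random variable with density $p_0$. Schedules: $\alpha_t,\sigma_t$ are differentiable functions of $t\in[0,1]$ with $\alpha_0=1$, $\alpha_1=0$, $\sigma_0=0$, $\sigma_1=1$, $\alpha_t,\sigma_t\ge 0$ on $[0,1]$, and $\alpha_t>0$, $\sigma_t>0$ for $t\in(0,1)$; a dot denotes $\mathrm{d}/\mathrm{d}t$. Coefficients: $f_t:=\dot\alpha_t/\alpha_t$ and $g_t^2:=\frac{\mathrm{d}}{\mathrm{d}t}\sigma_t^2-2\frac{\dot\alpha_t}{\alpha_t}\sigma_t^2$, assumed $\ge0$, with $g_t=\sqrt{g_t^2}$. Conditional kernel: $p_t(x\mid x_0):=\mathcal{N}(x;\alpha_tx_0,\sigma_t^2I)$. $W_t$ is a standard $d$-dimensional Brownian motion; differential operators act on $x$. Convention: an SDE $\mathrm{d}X_t=b_t(X_t)\mathrm{d}t+g_t\mathrm{d}W_t$ is said to generate the density path $p_t$ when $\partial_tp_t=-\nabla\cdot(b_tp_t)+\frac12g_t^2\Delta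 p_t$ and the law at the initial time is the prescribed one. *)

(* Defs.v *)
From HB Require Import structures.
From mathcomp Require Import all_boot all_order all_algebra.
From mathcomp Require Import all_classical all_reals all_analysis.

Set Implicit Arguments.
Unset Strict Implicit.
Unset Printing Implicit Defensive.

Import Order.TTheory GRing.Theory Num.Theory.
Import numFieldNormedType.Exports.

Local Open Scope classical_set_scope.
Local Open Scope ring_scope.

(* 'rV[R]_n carries the product sigma-algebra, i.e. the one generated by the
   coordinates (the library has this structure only on n.-tuple R). *)

Section measurable_row.
Context {d} {T : measurableType d}.
Variable n : nat.

Let coors : 'I_n -> 'rV[T]_n -> T := fun i x => x ord0 i.

Let row_set0 : g_sigma_preimage coors set0.
Proof. exact: sigma_algebra0. Qed.

Let row_setC A : g_sigma_preimage coors A -> g_sigma_preimage coors (~` A).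
Proof. exact: sigma_algebraC. Qed.

Let row_bigcup (F : _^nat) : (forall i, g_sigma_preimage coors (F i)) ->
  g_sigma_preimage coors (\bigcup_i (F i)).
Proof. exact: sigma_algebra_bigcup. Qed.

HB.instance Definition _ := @isMeasurable.Build (measure_tuple_display d)
  'rV[T]_n (g_sigma_preimage coors) row_set0 row_setC row_bigcup.

End measurable_row.

Lemma measurable_coord d (T : measurableType d) n (i : 'I_n) :
  measurable_fun [set: 'rV[T]_n] (fun x : 'rV[T]_n => x ord0 i).
Proof.
move=> _ Y mY; rewrite setTI; apply: sub_sigma_algebra => /=.
rewrite -bigcup_seq/=; exists i => /=; first by rewrite mem_index_enum.
by exists Y => //; rewrite setTI.
Qed.

Lemma measurable_fun_rowP d1 d2 (T1 : measurableType d1) (T2 : measurableType d2)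
    n (f : T1 -> 'rV[T2]_n) :
  (forall i, measurable_fun [set: T1] (fun x => f x ord0 i)) ->
  measurable_fun [set: T1] f.
Proof.
move=> mf.
have sub : g_sigma_preimage (fun i x => f x ord0 i) `<=` measurable.
  apply: smallest_sub; first exact: sigma_algebra_measurable.
  rewrite -bigcup_seq; apply: bigcup_sub => i _ A [B mB <-]; exact: mf.
move=> _ A mA; apply: sub.
rewrite (g_sigma_preimage_comp (fun i (x : 'rV[T2]_n) => x ord0 i) f).
by exists A.
Qed.

Section lebesgue_row.
Variable R : realType.

Definition row_cons n (p : R * 'rV[R]_n) : 'rV[R]_n.+1 :=
  row_mx (const_mx p.1 : 'rV[R]_1) p.2.

Definition row_uncons n (x : 'rV[R]_n.+1) : R * 'rV[R]_n :=
  (x ord0 ord0, rsubmx (x : 'rV[R]_(1 + n))).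

Lemma row_consK n : cancel (@row_cons n) (@row_uncons n).
Proof.
case=> a v; rewrite /row_uncons /row_cons /= row_mxKr; congr (_, _).
by rewrite mxE; case: splitP => [j _|//]; rewrite mxE.
Qed.

Lemma row_unconsK n : cancel (@row_uncons n) (@row_cons n).
Proof.
move=> x; apply/rowP => i; rewrite /row_cons mxE.
case: (@splitP 1 n i) => j ij; rewrite !mxE; congr (x _ _); apply/val_inj.
  by rewrite /= ij ord1.
by rewrite /= ij.
Qed.

Lemma measurable_row_cons n : measurable_fun setT (@row_cons n).
Proof.
apply: measurable_fun_rowP => i.
pose c (p : R * 'rV[R]_n) :=
  match @fintype.split 1 n i with inl _ => p.1 | inr j => p.2 ord0 j end.
apply: (eq_measurable_fun c) => [p _|].
  by rewrite mxE /c; case: fintype.split => j; rewrite ?mxE.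
rewrite /c; case: fintype.split => j; first exact: measurable_fst.
exact: (measurableT_comp (@measurable_coord _ R n j) measurable_snd).
Qed.

Lemma measurable_row_uncons n : measurable_fun setT (@row_uncons n).
Proof.
apply: measurable_fun_pair; first exact: (@measurable_coord _ R).
apply: measurable_fun_rowP => i; under eq_fun do rewrite mxE.
exact: (@measurable_coord _ R n.+1 (rshift 1 i)).
Qed.

Section step.
Variables (n : nat) (m : {sigma_finite_measure set 'rV[R]_n -> \bar R}).

Definition lebesgue_step : set 'rV[R]_n.+1 -> \bar R :=
  pushforward (@lebesgue_measure R \x m)%E (@row_cons n).

Let measurable_cons (A : set 'rV[R]_n.+1) :
  measurable A -> measurable (@row_cons n @^-1` A).
Proof.
by move=> mA; rewrite -[X in measurable X]setTI; exact: measurable_row_cons.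
Qed.

Let lebesgue_step0 : lebesgue_step set0 = 0%E.
Proof. by rewrite /lebesgue_step /pushforward preimage_set0 measure0. Qed.

Let lebesgue_step_ge0 A : (0 <= lebesgue_step A)%E.
Proof. exact: (measure_ge0 (@lebesgue_measure R \x m)%E). Qed.

Let lebesgue_step_sigma_additive : semi_sigma_additive lebesgue_step.
Proof.
move=> F mF tF mUF; rewrite /lebesgue_step /pushforward preimage_bigcup.
apply: measure_semi_sigma_additive.
- by move=> k; exact: measurable_cons.
- apply/trivIsetP => /= i j _ _ ij; rewrite -preimage_setI.
  by move/trivIsetP : tF => /(_ _ _ _ _ ij) ->//; rewrite preimage_set0.
- by rewrite -preimage_bigcup; exact: measurable_cons.
Qed.

HB.instance Definition _ := isMeasure.Build _ _ _ lebesgue_step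
  lebesgue_step0 lebesgue_step_ge0 lebesgue_step_sigma_additive.

Lemma sigma_finite_lebesgue_step : sigma_finite setT lebesgue_step.
Proof.
have /sigma_finiteP[F [TF ndF Foo]] := sigma_finiteT (@lebesgue_measure R).
have /sigma_finiteP[G [TG ndG Goo]] := sigma_finiteT m.
exists (fun k => @row_uncons n @^-1` (F k `*` G k)).
  rewrite -preimage_bigcup -(preimage_setT (@row_uncons n)); congr (_ @^-1` _).
  rewrite -setXTT TF TG predeqE => -[x y]; split.
    move=> [/= [j _ Fjx] [k _ Gky]]; exists (maxn j k) => //; split.
    - by move: x Fjx; exact/subsetPset/ndF/leq_maxl.
    - by move: y Gky; exact/subsetPset/ndG/leq_maxr.
  by move=> [k _ []/= ? ?]; split; exists k.
move=> k; have [mF Fk_fin] := Foo k; have [mG Gk_fin] := Goo k; split.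
  rewrite -[X in measurable X]setTI.
  by apply: measurable_row_uncons => //; exact: measurableX.
rewrite /lebesgue_step /pushforward -comp_preimage.
rewrite (_ : _ \o _ = id); last by apply/funext => p /=; rewrite row_consK.
by rewrite product_measure1E// lte_mul_pinfty// ge0_fin_numE.
Qed.

HB.instance Definition _ := @Measure_isSigmaFinite.Build _ _ _
  lebesgue_step sigma_finite_lebesgue_step.

Definition lebesgue_stepS :
  {sigma_finite_measure set 'rV[R]_n.+1 -> \bar R} := lebesgue_step.

End step.

(* Lebesgue measure on R^n as the n-fold product of Lebesgue measure on R
   (the point mass on the one-point space R^0). *)
Fixpoint lebesgue_row n : {sigma_finite_measure set 'rV[R]_n -> \bar R} :=
  match n with
  | 0 => \d_(0 : 'rV[R]_0)
  | n'.+1 => lebesgue_stepS (lebesgue_row n')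
  end.

Lemma lebesgue_row_box d (A : 'I_d -> set R) :
  (forall i, measurable (A i)) ->
  lebesgue_row d [set x | forall i, A i (x ord0 i)] =
  (\prod_(i < d) lebesgue_measure (A i))%E.
Proof.
elim: d A => [|d IH] A mA.
  rewrite big_ord0 /= diracE mem_set//=; by case.
rewrite big_ord_recl -IH; last by move=> i; exact: mA.
rewrite /=.
rewrite /lebesgue_step /pushforward.
have m2 : measurable [set x : 'rV[R]_d | forall i, A (lift ord0 i) (x ord0 i)].
  rewrite (_ : [set _ | _] = \bigcap_(i in [set: 'I_d])
      ((fun x : 'rV[R]_d => x ord0 i) @^-1` A (lift ord0 i))).
    apply: fin_bigcap_measurable => // i _; rewrite -[X in measurable X]setTI.
    exact: measurable_coord.
  apply/seteqP; split => x /= h i; first by move=> _; exact: h.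
    exact: (h i I).
rewrite -product_measure1E; [|exact: mA|exact: m2].
congr (_ _); apply/seteqP; split => [[a v]|[a v]] /=.
  move=> h; split => [|i].
    by have := h ord0; rewrite /row_cons mxE; case: splitP => // j _; rewrite mxE.
  have := h (lift ord0 i); rewrite /row_cons mxE.
  case: splitP => [[] [] //|j /= /eqP]; rewrite /bump /= ?add0n ?add1n.
  by rewrite eqSS => /eqP e; rewrite (_ : i = j)//; exact/val_inj.
move=> [ha hv] i; rewrite /row_cons mxE; case: splitP => j ij.
  by rewrite mxE (_ : i = ord0) //; apply/val_inj; rewrite /= ij ord1.
by rewrite (_ : i = lift ord0 j) //; apply/val_inj; rewrite /= /bump/= ij.
Qed.

End lebesgue_row.

Section densities.
Variables (R : realType) (d : nat).
Implicit Types (p : 'rV[R]_d -> R) (x m : 'rV[R]_d).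

Definition probability_density p : Prop :=
  [/\ measurable_fun setT p, forall x, 0 <= p x &
      (\int[lebesgue_row R d]_x (p x)%:E = 1)%E].

Definition has_density (mu : set 'rV[R]_d -> \bar R) p : Prop :=
  [/\ measurable_fun setT p, forall x, 0 <= p x &
      forall A, measurable A ->
        mu A = (\int[lebesgue_row R d]_(x in A) (p x)%:E)%E].

(* Density at x of N(m, s^2 I), for s > 0. At s = 0, where the law is a point
   mass and has no density, the value is meaningless. *)
Definition gaussian_pdf m (s : R) x : R :=
  (Num.sqrt (2 * pi * s ^+ 2)) ^- d
  * expR (- (\sum_(i < d) (x ord0 i - m ord0 i) ^+ 2) / (2 * s ^+ 2)).

End densities.

Section differential_operators.
Variables (R : realType) (d : nat).

Definition unit_vec (i : 'I_d) : 'rV[R]_d := delta_mx ord0 i.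

Definition divergence (v : 'rV[R]_d -> 'rV[R]_d) (x : 'rV[R]_d) : R :=
  \sum_(i < d) 'D_(unit_vec i) (fun y => v y ord0 i) x.

Definition laplacian (h : 'rV[R]_d -> R) (x : 'rV[R]_d) : R :=
  \sum_(i < d) 'D_(unit_vec i) ('D_(unit_vec i) h) x.

End differential_operators.

Section sde.
Variables (R : realType) (d : nat).

(* The SDE dX_t = b_t(X_t) dt + g_t dW_t, X_0 ~ initial_law, represented by its
   data. *)
Record sde := Sde {
  drift : R -> 'rV[R]_d -> 'rV[R]_d;
  diffusion : R -> R;
  initial_law : probability 'rV[R]_d R }.

(* Derivatives are total functions in the library, so the existence of the
   derivatives occurring in the equation is part of the definition. *)
Definition fokker_planck (b : R -> 'rV[R]_d -> 'rV[R]_d) (g : R -> R)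
    (p : R -> 'rV[R]_d -> R) (t : R) (x : 'rV[R]_d) : Prop :=
  [/\ derivable (fun s => p s x) t 1,
      forall i, derivable (fun y => (p t y *: b t y) ord0 i) x (unit_vec R i),
      forall i y, derivable (p t) y (unit_vec R i),
      forall i, derivable ('D_(unit_vec R i) (p t)) x (unit_vec R i) &
      derive1 (fun s => p s x) t =
        - divergence (fun y => p t y *: b t y) x
        + 2^-1 * g t ^+ 2 * laplacian (p t) x].

(* p_t is only required to be a density for t in ]0, 1[ (for the Gaussian
   mixtures below, the kernel degenerates to a point mass at t = 0), so its law
   at the initial time is its weak limit as t decreases to 0. *)
Definition has_initial_law (p : R -> 'rV[R]_d -> R)
    (mu : probability 'rV[R]_d R) : Prop :=
  forall phi : 'rV[R]_d -> R, continuous phi ->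
    (exists M : R, forall x, `|phi x| <= M) ->
    \int[lebesgue_row R d]_x (phi x * p t x) @[t --> 0^'+]
      --> \int[mu]_x phi x.

Definition generates (S : sde) (p : R -> 'rV[R]_d -> R) : Prop :=
  [/\ forall t, 0 < t < 1 -> probability_density (p t),
      has_initial_law p (initial_law S) &
      forall t x, 0 < t < 1 -> fokker_planck (drift S) (diffusion S) p t x].

End sde.

Section schedules.
Variable R : realType.
Implicit Types alpha sigma : R -> R.

(* Differentiability on [0, 1], one-sided at the endpoints: values outside
   [0, 1] are irrelevant. *)
Definition differentiable_on01 (h : R -> R) : Prop :=
  forall t, 0 <= t <= 1 ->
    cvg ((h s - h t) / (s - t) @[s --> within (`[0, 1] `\ t) (nbhs t)]).

Record schedule alpha sigma : Prop := Schedule {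
  alpha_diff : differentiable_on01 alpha;
  sigma_diff : differentiable_on01 sigma;
  alpha_at0 : alpha 0 = 1;
  alpha_at1 : alpha 1 = 0;
  sigma_at0 : sigma 0 = 0;
  sigma_at1 : sigma 1 = 1;
  alpha_ge0 : forall t, 0 <= t <= 1 -> 0 <= alpha t;
  sigma_ge0 : forall t, 0 <= t <= 1 -> 0 <= sigma t;
  alpha_gt0 : forall t, 0 < t < 1 -> 0 < alpha t;
  sigma_gt0 : forall t, 0 < t < 1 -> 0 < sigma t }.

Definition f_coef alpha (t : R) : R := derive1 alpha t / alpha t.

Definition g2_coef alpha sigma (t : R) : R :=
  derive1 (fun s => sigma s ^+ 2) t
  - 2 * (derive1 alpha t / alpha t) * sigma t ^+ 2.

Definition g_coef alpha sigma (t : R) : R := Num.sqrt (g2_coef alpha sigma t).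

Definition cond_pdf d alpha sigma (t : R) (x0 x : 'rV[R]_d) : R :=
  gaussian_pdf (alpha t *: x0) (sigma t) x.

Definition marginal_pdf d alpha sigma (p0 : 'rV[R]_d -> R)
    (t : R) (x : 'rV[R]_d) : R :=
  \int[lebesgue_row R d]_x0 (cond_pdf alpha sigma t x0 x * p0 x0).

End schedules.

(* Main.v *)
(* The density p_t is the mixture, over the law mu of X_0, of the Gaussian
   kernels N(alpha_t y, sigma_t^2 I). For fixed y the kernel satisfies the
   Fokker-Planck equation by direct computation, so it suffices to
   differentiate under the integral. In x, the derivatives of the kernel are
   bounded uniformly in y. In t, alpha and sigma are merely differentiable, so
   the derivative of the kernel need not be dominated near t; but the kernel is
   Lipschitz in (alpha, sigma) uniformly in y, because its Gaussian decay
   absorbs the growth in y, and alpha and sigma are Lipschitz at t, which is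
   enough for dominated convergence of the difference quotients.
   For the initial law, Fubini and the substitution x = alpha_t y + sigma_t z
   turn the integral of phi p_t into the expectation of
   phi (alpha_t X_0 + sigma_t Z) with Z standard normal independent of X_0. *)
Require Import Defs.
From HB Require Import structures.
From mathcomp Require Import all_boot all_order all_algebra.
From mathcomp Require Import all_classical all_reals all_analysis.
From mathcomp Require Import measurable_realfun ring lra.
Import Order.TTheory GRing.Theory Num.Theory.
Import numFieldNormedType.Exports.
Local Open Scope classical_set_scope.
Local Open Scope ring_scope.

(** * Integration on R^d *)

Section integral_density.
Context d (T : measurableType d) (R : realType).
Variables (nu : {finite_measure set T -> \bar R})
  (mu : {sigma_finite_measure set T -> \bar R}).

(** The density hypothesis makes [nu] absolutely continuous with respect to [mu], and [p],
    integrable because [nu] is finite, agrees almost everywhere with the Radon-Nikodym derivative,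
    whose change of variables formula concludes. *)
Lemma integral_density (p : T -> R) (h : T -> R) :
  measurable_fun setT p -> (forall x, 0 <= p x) ->
  (forall A, measurable A -> nu A = (\int[mu]_(x in A) (p x)%:E)%E) ->
  nu.-integrable setT (EFin \o h) ->
  (\int[mu]_x (h x * p x)%:E = \int[nu]_x (h x)%:E)%E.
Proof.
move=> mp p0 nuE inth.
have nu_mu : nu `<< mu.
  apply/null_content_dominatesP => A mA A0; rewrite nuE//.
  by apply: null_set_integral => //; exact/measurable_EFinP/measurable_funTS.
rewrite -(Radon_Nikodym_change_of_variables nu_mu measurableT inth).
have mRN :=
  @Radon_Nikodym_integrable _ _ _ (charge_of_finite_measure nu) mu nu_mu.
apply: ae_eq_integral => //.
- apply/measurable_EFinP/measurable_funM => //.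
  by case/integrableP: inth => /measurable_EFinP.
- apply: emeasurable_funM; first by case/integrableP: inth.
  exact: measurable_int mRN.
rewrite [X in ae_eq _ _ X](_ : _ = (EFin \o h) \* (EFin \o p))%E; last first.
  by apply/funext => x /=; rewrite EFinM.
apply: ae_eqe_mul2l; apply: integral_ae_eq => //.
- apply/integrableP; split; first exact/measurable_EFinP.
  under eq_integral do rewrite /= ger0_norm//.
  by rewrite -nuE// ltey_eq fin_num_measure.
- by move=> A _ mA; rewrite -nuE// -Radon_Nikodym_integral.
Qed.

End integral_density.

Section integral_lebesgue_row.
Variable R : realType.
Local Notation lambda := (@lebesgue_measure R).

(** Lebesgue measure equals [s] times its pushforward under $z \mapsto m + sz$: by uniqueness it is
    enough to compare the two on half-open intervals. *)
Lemma integral_affine1 (m s : R) (f : R -> \bar R) :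
  0 < s -> measurable_fun setT f -> (forall x, 0 <= f x)%E ->
  (\int[lambda]_x f x = s%:E * \int[lambda]_z f (m + s * z)%R)%E.
Proof.
move=> s0 mf f0.
pose phi (z : measurableTypeR R) : measurableTypeR R := m + s * z.
have mphi : measurable_fun setT phi.
  by apply: measurable_funD => //; exact: measurable_funM.
pose phi' : {mfun measurableTypeR R >-> measurableTypeR R} :=
  HB.pack phi (isMeasurableFun.Build _ _ _ _ phi mphi).
pose k : {nonneg R} := NngNum (ltW s0).
have E X : measurable X -> lambda X =
    mscale k (pushforward lambda phi') X.
  apply: (@lebesgue_measure_unique R (mscale k (pushforward lambda phi'))).
  move=> {}X [[a b]]/= _ <-.
  rewrite /mscale/= /pushforward.
  rewrite (_ : phi @^-1` `]a, b]%classic =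
    `](a - m) / s, (b - m) / s]%classic); last first.
    apply/seteqP; split => z; rewrite /phi /= !in_itv/=;
      by rewrite ltr_pdivrMr// ler_pdivlMr// [_ * s]mulrC ltrBlDl lerBrDl.
  rewrite !lebesgue_measure_itv/= !lte_fin ltr_pM2r ?invr_gt0// ltrD2r.
  case: ifPn => ab; last by rewrite mule0.
  rewrite -!EFinB -EFinM; congr EFin.
  by field; rewrite gt_eqF.
rewrite (eq_measure_integral (mscale k (pushforward lambda phi'))); last first.
  by move=> A mA _; exact: E.
rewrite ge0_integral_mscale//= ge0_integral_pushforward//.
Qed.

(** The measure in dimension [n.+1] is by construction the pushforward of a product measure under
    [row_cons], so Tonelli applies. This is the inductive step of every computation on rows
    below. *)
Lemma integral_lebesgue_rowS n (f : 'rV[R]_n.+1 -> \bar R) :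
  measurable_fun setT f -> (forall x, 0 <= f x)%E ->
  (\int[lebesgue_row R n.+1]_x f x =
   \int[lambda]_a \int[lebesgue_row R n]_v f (row_cons (a, v)))%E.
Proof.
move=> mf f0.
pose c : measurableTypeR R * 'rV[R]_n -> 'rV[R]_n.+1 := @row_cons R n.
have mc : measurable_fun setT c by exact: (@measurable_row_cons R n).
pose phi : {mfun (measurableTypeR R * 'rV[R]_n)%type >-> 'rV[R]_n.+1} :=
  HB.pack c (isMeasurableFun.Build _ _ _ _ c mc).
rewrite (eq_measure_integral (pushforward (lambda \x lebesgue_row R n)%E phi));
  last by [].
rewrite ge0_integral_pushforward//=.
rewrite (fubini_tonelli1 (f \o c))//.
  exact: (measurableT_comp mf mc).
by move=> x; exact: f0.
Qed.

End integral_lebesgue_row.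

(** * Affine substitution and product integrands on $\mathbb{R}^n$ *)

Section lebesgue_row_change_of_variables.
Variable R : realType.
Local Notation lambda := (@lebesgue_measure R).

Lemma measurable_row_affine n (m : 'rV[R]_n) (s : R) :
  measurable_fun setT (fun z : 'rV[R]_n => m + s *: z).
Proof.
apply: measurable_fun_rowP => i.
under eq_fun do rewrite !mxE.
apply: measurable_funD => //; apply: measurable_funM => //.
exact: measurable_coord.
Qed.

Lemma row_cons_coord0 n (a : R) (v : 'rV[R]_n) : row_cons (a, v) ord0 ord0 = a.
Proof. by have := row_consK (a, v); rewrite /row_uncons => -[]. Qed.

Lemma row_cons_lift n (a : R) (v : 'rV[R]_n) (i : 'I_n) :
  row_cons (a, v) ord0 (lift ord0 i) = v ord0 i.
Proof.
have <- := congr1 (fun p : R * 'rV[R]_n => p.2 ord0 i) (row_consK (a, v)).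
by rewrite /= [RHS]mxE; congr (row_cons _ _ _); exact/val_inj.
Qed.

Lemma row_cons_affine n (a b s : R) (m v : 'rV[R]_n) :
  row_cons (a + s * b, m + s *: v) = row_cons (a, m) + s *: row_cons (b, v).
Proof.
apply/rowP => i; rewrite [RHS]mxE [X in _ = _ + X]mxE.
case: (unliftP ord0 i) => [j|] ->.
- by rewrite !row_cons_lift !mxE.
- by rewrite !row_cons_coord0.
Qed.

Lemma measurable_row_consr n (a : R) :
  measurable_fun setT (fun v : 'rV[R]_n => row_cons (a, v)).
Proof.
apply: (measurableT_comp (@measurable_row_cons R n)).
exact: measurable_pair1.
Qed.

Lemma measurable_integral_row_cons n (f : 'rV[R]_n.+1 -> \bar R) :
  measurable_fun setT f -> (forall x, 0 <= f x)%E ->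
  measurable_fun setT
    (fun a : R => \int[lebesgue_row R n]_v f (row_cons (a, v)))%E.
Proof.
move=> mf f0.
apply: (measurable_fun_fubini_tonelli_F (f \o @row_cons R n)).
- exact: (measurableT_comp mf (@measurable_row_cons R n)).
- by move=> x; exact: f0.
Qed.

(** Induction on the dimension: the first coordinate contributes one factor [s] through the
    one-dimensional substitution. Both [m] and [f] vary in the induction, since it is applied to the
    tail of [m] and to slices of [f]. *)
Lemma integral_row_affine n (m : 'rV[R]_n) (s : R) (f : 'rV[R]_n -> \bar R) :
  0 < s -> measurable_fun setT f -> (forall x, 0 <= f x)%E ->
  (\int[lebesgue_row R n]_x f x =
   (s ^+ n)%:E * \int[lebesgue_row R n]_z f (m + s *: z)%R)%E.
Proof.
elim: n m f => [|n IH] m f s0 mf f0.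
  rewrite expr0 mul1e; apply: eq_integral => x _.
  by congr f; apply/rowP => -[].
rewrite !integral_lebesgue_rowS//; last first.
  exact: (measurableT_comp mf (measurable_row_affine _ _ _)).
rewrite (@integral_affine1 _ (m ord0 ord0) s
  (fun a => \int[lebesgue_row R n]_v f (row_cons (a, v)))%E s0); last 2 first.
- exact: measurable_integral_row_cons.
- by move=> a; exact: integral_ge0.
rewrite exprS EFinM -muleA; congr (_ * _)%E.
rewrite -ge0_integralZl//; last 3 first.
- apply: (@measurable_integral_row_cons _ (fun z => f (m + s *: z))) => //.
  exact: (measurableT_comp mf (measurable_row_affine _ _ _)).
- by move=> a _; exact: integral_ge0.
- by rewrite lee_fin exprn_ge0// ltW.
apply: eq_integral => b _.
rewrite (IH (rsubmx (m : 'rV_(1 + n))))//; last first.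
  exact: (measurableT_comp mf (measurable_row_consr _ _)).
congr (_ * _)%E; apply: eq_integral => v _.
(* The head and tail of [m], shifted separately, reassemble into [m]. *)
by rewrite row_cons_affine -[X in _ = f (X + _)]row_unconsK.
Qed.

Lemma integral_row_prod n (f : 'I_n -> R -> R) :
  (forall i, measurable_fun setT (f i)) -> (forall i x, 0 <= f i x) ->
  (\int[lebesgue_row R n]_x (\prod_(i < n) f i (x ord0 i))%:E =
   \prod_(i < n) \int[lambda]_x (f i x)%:E)%E.
Proof.
elim: n f => [|n IH] f mf f0.
  rewrite big_ord0; under eq_integral do rewrite big_ord0.
  by rewrite integral_cst// mul1e /= diracT.
rewrite integral_lebesgue_rowS; last 2 first.
- apply/measurable_EFinP/measurable_prod => i _.
  exact: (measurableT_comp (mf i) (@measurable_coord _ R _ _)).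
- by move=> x; rewrite lee_fin prodr_ge0.
rewrite big_ord_recl -IH//.
rewrite -ge0_integralZr//; last 3 first.
- apply/measurable_EFinP; exact: (mf ord0).
- by move=> x _; rewrite lee_fin.
- by apply: integral_ge0 => x _; rewrite lee_fin prodr_ge0.
apply: eq_integral => a _.
rewrite -ge0_integralZl//; last 3 first.
- apply/measurable_EFinP/measurable_prod => i _.
  exact: (measurableT_comp (mf _) (@measurable_coord _ R _ _)).
- by move=> x _; rewrite lee_fin prodr_ge0.
- by rewrite lee_fin.
apply: eq_integral => v _; rewrite big_ord_recl row_cons_coord0 EFinM.
by under eq_bigr do rewrite row_cons_lift.
Qed.

End lebesgue_row_change_of_variables.

(** * Measurability and differentiation under the integral *)

Section continuous_measurable_row.
Variables (R : realType) (d : nat).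

(** Index of the half-open cube of side $1/(n+1)$ that contains [x]; [grid_pt] returns the lower
    corner of a cube from its index. *)
Let grid n (x : 'rV[R]_d) : 'rV[int]_d :=
  \row_i Num.floor (x ord0 i * n.+1%:R).

Let grid_pt n (z : 'rV[int]_d) : 'rV[R]_d := \row_i ((z ord0 i)%:~R / n.+1%:R).

Let measurable_grid n z : measurable [set x : 'rV[R]_d | grid n x = z].
Proof.
rewrite (_ : [set _ | _] = \bigcap_(i in [set: 'I_d])
    ((fun x : 'rV[R]_d => x ord0 i) @^-1`
      `[(z ord0 i)%:~R / n.+1%:R, (z ord0 i + 1)%:~R / n.+1%:R[%classic)).
  apply: fin_bigcap_measurable => // i _; rewrite -[X in measurable X]setTI.
  exact: measurable_coord.
have E (x : 'rV[R]_d) i : Num.floor (x ord0 i * n.+1%:R) = z ord0 i <->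
    x ord0 i \in `[(z ord0 i)%:~R / n.+1%:R, (z ord0 i + 1)%:~R / n.+1%:R[.
  rewrite in_itv/= ler_pdivrMr ?ltr0n// ltr_pdivlMr ?ltr0n//.
  by rewrite -floor_eq; split => /eqP.
apply/seteqP; split => x /=.
  by move=> xz i _; apply/E; rewrite -xz mxE.
by move=> xz; apply/rowP => i; rewrite mxE; apply/E; exact: (xz i I).
Qed.

Let measurable_fun_grid n (phi : 'rV[R]_d -> R) :
  measurable_fun setT (fun x => phi (grid_pt n (grid n x))).
Proof.
move=> _ B mB; rewrite setTI.
(* The function is constant on each cube, and there are countably many cubes. *)
rewrite (_ : _ @^-1` _ = \bigcup_(z in [set: 'rV[int]_d])
   ([set x | grid n x = z] `&` [set _ | B (phi (grid_pt n z))])).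
  apply: (@countable_bigcupT_measurable _ _ _
    (fun z => [set x | grid n x = z]
       `&` [set _ | B (phi (grid_pt n z))])) => //.
  move=> z; apply: measurableI => //.
  have [Bz|Bz] := pselect (B (phi (grid_pt n z))).
    by rewrite (_ : [set _ | _] = setT)//; apply/seteqP; split.
  by rewrite (_ : [set _ | _] = set0)//; apply/seteqP; split.
apply/seteqP; split => x /=; first by move=> ?; exists (grid n x).
by move=> [z _ [/= -> ]].
Qed.

Let cvg_grid x : (fun n => grid_pt n (grid n x)) @ \oo --> x.
Proof.
apply/cvg_ballP => e e0; near=> n; split => // i j.
rewrite !mxE (ord1 i) /ball /= ltr_norml.
have n0 : (0 : R) < n.+1%:R by rewrite ltr0n.
have ne : n.+1%:R^-1 < e.
  by near: n; exact: (near_infty_natSinv_lt (PosNum e0)).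
set y := x ord0 j; have /andP[] := floor_itv (y * n.+1%:R).
rewrite -ler_pdivrMr// -ltr_pdivlMr// intrD mulrDl mul1r.
move: ne; set a := _ / _; set b := _^-1 => ? ? ?.
by apply/andP; split; lra.
Unshelve. all: end_near. Qed.

(** The sigma-algebra is generated by the coordinates, which makes cubes measurable; [phi] is the
    pointwise limit of its step approximations on finer and finer grids. *)
Lemma continuous_measurable_row (phi : 'rV[R]_d -> R) :
  continuous phi -> measurable_fun setT phi.
Proof.
move=> cphi.
apply: (measurable_fun_cvg (fun n => measurable_fun_grid n phi)) => x _.
exact: (cvg_comp _ _ (cvg_grid x) (cphi x)).
Qed.

End continuous_measurable_row.

Section derivative_under_integral.
Context d (Y : measurableType d) (R : realType).
Variable mu : {finite_measure set Y -> \bar R}.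

Lemma bounded_integrable (f : Y -> R) (M : R) :
  measurable_fun setT f -> (forall y, `|f y| <= M) ->
  mu.-integrable setT (EFin \o f).
Proof.
move=> mf fM; apply: measurable_bounded_integrable => //.
  by rewrite ltey_eq fin_num_measure.
exists M; split; first exact: num_real.
by move=> x Mx y _ /=; rewrite (le_trans (fM y))// ltW.
Qed.

(* The Lipschitz bound is only required at the point t: a domination of the
   derivatives on a neighbourhood of t would fail for schedules whose
   derivatives are unbounded near t. *)
Lemma is_derive_integral (F : R -> Y -> R) (dF : Y -> R) (t C : R) :
  (forall s, mu.-integrable setT (EFin \o F s)) ->
  (forall y, is_derive t 1 (F ^~ y) (dF y)) ->
  (\forall s \near t, forall y, `|F s y - F t y| <= C * `|s - t|) ->
  [/\ mu.-integrable setT (EFin \o dF) &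
      is_derive t 1 (fun s => \int[mu]_y F s y) (\int[mu]_y dF y)].
Proof.
move=> intF dFE [e /= e0 FC].
pose g h y := h^-1 * (F (h + t) y - F t y).
have intg h : mu.-integrable setT (EFin \o g h).
  have := integrableB measurableT (intF (h + t)) (intF t).
  move=> /(integrableZl measurableT h^-1).
  by apply: eq_integrable => // y _ /=; rewrite /g EFinM EFinB.
have gC h y : `|h| < e -> `|g h y| <= C.
  move=> he; rewrite normrM normfV.
  (* At [h = 0] the quotient is 0, because [0^-1 = 0]; that [C] is nonnegative is read off the
     Lipschitz bound at [t + e / 2]. *)
  have [->|h0] := eqVneq h 0.
    rewrite normr0 invr0 mul0r.
    have : `|t + e / 2 - t| < e.
      by rewrite addrAC subrr add0r gtr0_norm ?divr_gt0//; lra.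
    move=> /[dup] ?.
    have := FC (t + e / 2); rewrite /= distrC => /[apply] /(_ y).
    rewrite [t + _]addrC addrK => H.
    have : 0 <= C * `|e / 2| by exact: le_trans H.
    by rewrite pmulr_lge0// normr_gt0 gt_eqF// divr_gt0.
  rewrite ler_pdivrMl ?normr_gt0// mulrC.
  by have := FC (h + t); rewrite /= distrC addrK => /(_ he).
have cg (u : R^nat) y : (forall n, u n != 0) /\ u n @[n --> \oo] --> 0 ->
    g (u n) y @[n --> \oo] --> dF y.
  move=> u0.
  have [/cvg_ex[l lF]] := dFE y.
  have -> : 'D_1 (F^~ y) t = l by apply/cvg_lim.
  move=> <-; move/cvgr_dnbhsP : lF => /(_ u u0).
  by apply: cvg_trans; apply: near_eq_cvg; near=> n; rewrite /g /= scaler1.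
have dct (u : R^nat) : (forall n, u n != 0) /\ u n @[n --> \oo] --> 0 ->
    mu.-integrable setT (EFin \o dF) /\
    \int[mu]_y g (u n) y @[n --> \oo] --> \int[mu]_y dF y.
  move=> u0.
  (* Domination is required for every index, so the first [N] terms, where the increment may exceed
     [e], are dropped by a shift. *)
  have [N _ uN] : \forall n \near \oo, `|u n| < e.
    by have /cvgr0_norm_lt/(_ _ e0) := u0.2.
  pose v n := u (n + N)%N.
  have v0 : (forall n, v n != 0) /\ v n @[n --> \oo] --> 0.
    by split => [n|]; [exact: u0.1|rewrite (cvg_shiftn N); exact: u0.2].
  have [|||||intdF _ cvF] := @dominated_convergence _ _ _ mu _ measurableT
    (fun n y => (g (v n) y)%:E) (EFin \o dF) (EFin \o cst C).
  - by move=> n; case/integrableP: (intg (v n)).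
  - apply: (@emeasurable_fun_cvg _ _ _ _ (fun n y => (g (v n) y)%:E)).
      by move=> n; case/integrableP: (intg (v n)).
    by move=> y _; apply: cvg_EFin; [exact: nearW|exact: cg].
  - by apply: aeW => y _; apply: cvg_EFin; [exact: nearW|exact: cg].
  - exact: finite_measure_integrable_cst.
  - apply: aeW => y n _; rewrite lee_fin gC// uN//=; exact: leq_addl.
  split => //.
  rewrite -(cvg_shiftn N).
  by apply: fine_cvg; rewrite fineK //; exact: integrable_fin_num.
(* Integrability of [dF] does not depend on the sequence of increments; $1/(n+1)$ serves as a
   witness. *)
have [intdF _] : mu.-integrable setT (EFin \o dF) /\ True.
  have [|//] := dct (fun n => n.+1%:R^-1); split; last exact: cvg_harmonic.
  by move=> n; rewrite invr_neq0// pnatr_eq0.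
split => //.
have lim : h^-1 *: ((\int[mu]_y F (h *: 1 + t) y) - \int[mu]_y F t y)
    @[h --> 0^'] --> \int[mu]_y dF y.
  apply/cvgr_dnbhsP => u u0.
  have [_] := dct u u0.
  apply: cvg_trans; apply: near_eq_cvg; near=> n.
  rewrite /= scaler1 -RintegralB//= /g RintegralZl//.
  have := integrableB measurableT (intF (u n + t)) (intF t).
  by apply: eq_integrable => // y _ /=; rewrite EFinB.
apply: DeriveDef; first by apply/cvg_ex; exists (\int[mu]_y dF y).
exact/cvg_lim.
Unshelve. all: end_near. Qed.

End derivative_under_integral.

(** * The Gaussian kernel *)

Section gaussian.
Variables (R : realType) (d : nat).
Implicit Types (m x : 'rV[R]_d) (s : R).

Lemma sqrt_2pi_sqr s : 0 <= s ->
  Num.sqrt (2 * pi * s ^+ 2) = Num.sqrt (2 * pi) * s.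
Proof.
move=> s0; rewrite sqrtrM ?sqrtr_sqr ?ger0_norm//.
by rewrite mulr_ge0// pi_ge0.
Qed.

Lemma sqrt_2pi_gt0 : 0 < Num.sqrt (2 * pi) :> R.
Proof. by rewrite sqrtr_gt0 mulr_gt0// pi_gt0. Qed.

Lemma gaussian_pdf_ge0 m s x : 0 <= gaussian_pdf m s x.
Proof. by rewrite mulr_ge0 ?expR_ge0// invr_ge0 exprn_ge0// sqrtr_ge0. Qed.

Lemma gaussian_pdf_le m s x :
  gaussian_pdf m s x <= (Num.sqrt (2 * pi * s ^+ 2)) ^- d.
Proof.
rewrite /gaussian_pdf ler_piMr//.
rewrite -[leRHS]expR0 ler_expR mulNr oppr_le0 divr_ge0//.
  by apply: sumr_ge0 => i _; exact: sqr_ge0.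
by rewrite mulr_ge0// sqr_ge0.
Qed.

Lemma measurable_gaussian_pdf d' (T : measurableType d')
    (u v : T -> 'rV[R]_d) s :
  measurable_fun setT u -> measurable_fun setT v ->
  measurable_fun setT (fun z => gaussian_pdf (u z) s (v z)).
Proof.
move=> mu mv; apply: measurable_funM => //.
apply: measurableT_comp => //; apply: measurable_funM => //.
apply: measurableT_comp => //; apply: measurable_sum => i.
apply: measurable_funX; apply: measurable_funB.
- exact: (measurableT_comp (@measurable_coord _ R _ i) mv).
- exact: (measurableT_comp (@measurable_coord _ R _ i) mu).
Qed.

(** The covariance is a multiple of the identity, so the density factors over coordinates;
    normalisation then reduces to dimension one. *)
Lemma gaussian_pdf_normal m s x : 0 < s ->
  gaussian_pdf m s x = \prod_(i < d) normal_pdf (m ord0 i) s (x ord0 i).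
Proof.
move=> s0; under eq_bigr do rewrite normal_pdfE ?gt_eqF//.
rewrite big_split/= prodr_const card_ord /normal_peak /normal_fun -expR_sum.
rewrite /gaussian_pdf exprVn; congr (_ ^- _ * expR _).
  by congr Num.sqrt; rewrite -mulr_natr; ring.
rewrite -sumrN mulr_suml; apply: eq_bigr => i _.
by congr (_ / _); rewrite -mulr_natr; ring.
Qed.

Lemma integral_gaussian_pdf m s : 0 < s ->
  (\int[lebesgue_row R d]_x (gaussian_pdf m s x)%:E = 1)%E.
Proof.
move=> s0; under eq_integral do rewrite gaussian_pdf_normal//.
rewrite (integral_row_prod _ d (fun i => normal_pdf (m ord0 i) s)).
- by rewrite big1// => i _; exact: integral_normal_pdf.
- by move=> i; exact: measurable_normal_pdf.
- by move=> i x; exact: normal_pdf_ge0.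
Qed.

(** The Jacobian $s^d$ of the substitution $x = m + sz$ cancels against the normalising constant. *)
Lemma gaussian_pdf_affine m s z : 0 < s ->
  s ^+ d * gaussian_pdf m s (m + s *: z) = gaussian_pdf 0 1 z.
Proof.
move=> s0; rewrite /gaussian_pdf !sqrt_2pi_sqr// ?ltW// mulr1 exprMn invfM.
have sd0 : s ^+ d != 0 by rewrite expf_neq0// gt_eqF.
rewrite !mulrA; congr (_ * expR _); first by rewrite mulrAC divff// mul1r.
rewrite !mulNr !mulr1; congr (- _).
under eq_bigr do rewrite !mxE addrAC subrr add0r exprMn.
rewrite -mulr_sumr; under [in RHS]eq_bigr do rewrite !mxE subr0.
by field; rewrite gt_eqF.
Qed.

Lemma integral_gaussian_affine m s (f : 'rV[R]_d -> R) : 0 < s ->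
  measurable_fun setT f -> (forall x, 0 <= f x) ->
  (\int[lebesgue_row R d]_x (f x * gaussian_pdf m s x)%:E =
   \int[lebesgue_row R d]_z (f (m + s *: z) * gaussian_pdf 0 1 z)%:E)%E.
Proof.
move=> s0 mf f0.
have maff := measurable_row_affine R d m s.
rewrite (integral_row_affine _ _ m s)//; last 2 first.
- apply/measurable_EFinP/measurable_funM => //.
  exact: measurable_gaussian_pdf.
- by move=> x; rewrite lee_fin mulr_ge0// gaussian_pdf_ge0.
rewrite -ge0_integralZl//; last 3 first.
- apply/measurable_EFinP/measurable_funM.
    exact: (measurableT_comp mf maff).
  exact: measurable_gaussian_pdf.
- by move=> x _; rewrite lee_fin mulr_ge0// gaussian_pdf_ge0.
- by rewrite lee_fin exprn_ge0// ltW.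
apply: eq_integral => z _; rewrite -EFinM mulrCA gaussian_pdf_affine//.
Qed.

End gaussian.

(** * Directional derivatives as derivatives along lines *)

Section directional.
Variables (R : realType) (V : normedModType R).
Implicit Types (f : V -> R) (x v : V).

(** Both sides are limits of the same difference quotient. This transfers one-variable tools, such
    as the mean value theorem, to directional derivatives. *)
Lemma is_derive_line f x v (l h : R) :
  is_derive h 1 (fun k : R => f (k *: v + x)) l <->
  is_derive (h *: v + x) v f l.
Proof.
have E : (fun k : R => k^-1 *: (f ((k *: 1 + h) *: v + x) - f (h *: v + x))) =
    (fun k => k^-1 *: (f (k *: v + (h *: v + x)) - f (h *: v + x))).
  by apply/funext => k; rewrite scaler1 scalerDl addrA.
split=> -[D DE].
- apply: DeriveDef; first by move: D; rewrite /derivable /= E.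
  by rewrite -DE /derive /= E.
- apply: DeriveDef; first by rewrite /derivable /= E.
  by rewrite -DE /derive /= E.
Qed.

Lemma is_derive_line0 f x v (l : R) :
  is_derive (0 : R) 1 (fun k : R => f (k *: v + x)) l <-> is_derive x v f l.
Proof. by have := is_derive_line f x v l 0; rewrite scale0r add0r. Qed.

Lemma derive_bounded_lipschitz (g dg : R -> R) (C : R) :
  (forall h : R, is_derive h 1 g (dg h)) -> (forall h, `|dg h| <= C) ->
  forall a b, `|g a - g b| <= C * `|a - b|.
Proof.
move=> gE gC.
have cg : continuous g.
  by move=> h; apply/differentiable_continuous/derivable1_diffP; case: (gE h).
have le a b : a <= b -> `|g b - g a| <= C * `|b - a|.
  move=> ab; have [|c _ ->] := MVT_segment ab (fun h _ => gE h).
    exact: continuous_subspaceT.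
  by rewrite normrM ler_wpM2r.
move=> a b; have [ab|/ltW ba] := leP a b; last exact: le.
by rewrite distrC (distrC a) le.
Qed.

End directional.

(* The library states these for the pointwise operations on functions; the
   forms below apply to explicit expressions. *)
Section expression_derivatives.
Variables (R : realType) (V : normedModType R) (t v : V).
Implicit Types (f g : V -> R) (a b : R).

Lemma is_derive_fcst a : is_derive t v (fun=> a) 0.
Proof. exact: is_derive_cst. Qed.

Lemma is_derive_fD f g a b : is_derive t v f a -> is_derive t v g b ->
  is_derive t v (fun s => f s + g s) (a + b).
Proof. exact: is_deriveD. Qed.

Lemma is_derive_fN f a : is_derive t v f a ->
  is_derive t v (fun s => - f s) (- a).
Proof. exact: is_deriveN. Qed.

Lemma is_derive_fM f g a b : is_derive t v f a -> is_derive t v g b ->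
  is_derive t v (fun s => f s * g s) (a * g t + f t * b).
Proof.
move=> fa gb; apply: (is_derive_eq (is_deriveM fa gb)).
by rewrite /GRing.scale/=; ring.
Qed.

Lemma is_derive_fsum n (f : 'I_n -> V -> R) (a : 'I_n -> R) :
  (forall i, is_derive t v (f i) (a i)) ->
  is_derive t v (fun s => \sum_(i < n) f i s) (\sum_(i < n) a i).
Proof.
move=> fa; rewrite (_ : (fun _ => _) = \sum_(i < n) f i).
  exact: is_derive_sum.
by apply/funext => s; rewrite fct_sumE.
Qed.

Lemma is_derive_fX f a n : is_derive t v f a ->
  is_derive t v (fun s => f s ^+ n) (n%:R * f t ^+ n.-1 * a).
Proof.
move=> fa; rewrite (_ : (fun _ => _) = f ^+ n); first exact: is_deriveX.
by apply/funext => s; rewrite fctE.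
Qed.

End expression_derivatives.
Arguments is_derive_fcst {R V} t v a.
Arguments is_derive_fD {R V t v f g a b}.
Arguments is_derive_fN {R V t v f a}.
Arguments is_derive_fM {R V t v f g a b}.
Arguments is_derive_fsum {R V t v n f a}.
Arguments is_derive_fX {R V t v f a} n.

Lemma is_derive_fV (R : realType) (t : R) (f : R -> R) (a : R) :
  f t != 0 -> is_derive t 1 f a ->
  is_derive t 1 (fun s => (f s)^-1) (- (f t) ^- 2 * a).
Proof. exact: is_deriveV. Qed.
Arguments is_derive_fV {R t f a}.

Lemma is_derive_fexpR (R : realType) (t : R) (f : R -> R) (a : R) :
  is_derive t 1 f a -> is_derive t 1 (fun s => expR (f s)) (expR (f t) * a).
Proof. move=> fa; exact: (is_derive1_comp (is_derive_expR _) fa). Qed.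
Arguments is_derive_fexpR {R t f a}.

Section derivative_under_integral_direction.
Context d (Y : measurableType d) (R : realType) (V : normedModType R).
Variable mu : {finite_measure set Y -> \bar R}.

(** On the line through [x] along [v], the mean value theorem turns the bound on [dF] into a
    Lipschitz bound uniform in [y], as [is_derive_integral] requires. *)
Lemma is_derive_integral_dir (F dF : V -> Y -> R) (v : V) (C : R) :
  (forall x, mu.-integrable setT (EFin \o F x)) ->
  (forall x y, is_derive x v (F ^~ y) (dF x y)) ->
  (forall x y, `|dF x y| <= C) ->
  forall x, is_derive x v (fun x => \int[mu]_y F x y) (\int[mu]_y dF x y).
Proof.
move=> intF dFE dFC x; apply/is_derive_line0.
have dl y (h : R) :
    is_derive h 1 (fun k : R => F (k *: v + x) y) (dF (h *: v + x) y).
  by apply/(is_derive_line _ _ (F^~ y)).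
have [|||_] :=
  @is_derive_integral _ Y R mu (fun k => F (k *: v + x)) (dF x) 0 C.
- by move=> s; exact: intF.
- by move=> y; have := dl y 0; rewrite scale0r add0r.
(* The Lipschitz bound holds on the whole line, so the radius is arbitrary. *)
- exists 1 => //= s _ y.
  exact: (derive_bounded_lipschitz _ _ _ _ (dl y) (fun h => dFC _ y)).
- by [].
Qed.

End derivative_under_integral_direction.

(** * Spatial derivatives of the Gaussian kernel and their bounds *)

Section gaussian_space_derivatives.
Variables (R : realType) (d : nat).
Implicit Types (m x : 'rV[R]_d) (s : R).

Lemma is_derive_coord x (i : 'I_d) :
  is_derive x (unit_vec R i) (fun y : 'rV[R]_d => y ord0 i) 1.
Proof.
apply/is_derive_line0.
rewrite (_ : (fun _ => _) = id + cst (x ord0 i)); last first.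
  by apply/funext => k; rewrite !mxE !eqxx mulr1.
by rewrite -[X in is_derive _ _ _ X]addr0; exact: is_deriveD.
Qed.

Definition gaussian_dx (i : 'I_d) m s x : R :=
  - ((x ord0 i - m ord0 i) / s ^+ 2) * gaussian_pdf m s x.

Definition gaussian_dxx (i : 'I_d) m s x : R :=
  ((x ord0 i - m ord0 i) ^+ 2 / s ^+ 4 - s ^- 2) * gaussian_pdf m s x.

Lemma is_derive_gaussian_pdf i m s x : s != 0 ->
  is_derive x (unit_vec R i) (gaussian_pdf m s) (gaussian_dx i m s x).
Proof.
move=> s0; apply/is_derive_line0; rewrite /gaussian_dx /gaussian_pdf.
set c := _ ^- d.
(* Along [unit_vec R i] only one square varies; the others form the constant [Q], which leaves a
   one-variable computation. *)
pose Q := \sum_(j < d | j != i) (x ord0 j - m ord0 j) ^+ 2.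
set w := x ord0 i - m ord0 i.
have E h : \sum_(j < d) ((h *: unit_vec R i + x) ord0 j - m ord0 j) ^+ 2 =
    Q + (h + w) ^+ 2.
  rewrite (bigD1 i)//= addrC; congr (_ + _).
    apply: eq_bigr => j ji; rewrite !mxE eqxx/= (negbTE ji) mulr0 add0r//.
  by rewrite !mxE !eqxx mulr1 addrA.
under eq_fun do rewrite E.
have -> : \sum_(j < d) (x ord0 j - m ord0 j) ^+ 2 = Q + (0 + w) ^+ 2.
  by rewrite -E scale0r add0r.
have d1 := is_derive_fD (is_derive_id (0 : R) (1 : R))
  (is_derive_fcst (0 : R) (1 : R) w).
have d2 := is_derive_fD (is_derive_fcst (0 : R) (1 : R) Q) (is_derive_fX 2 d1).
have d3 := is_derive_fM (is_derive_fN d2)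
  (is_derive_fcst (0 : R) (1 : R) (2 * s ^+ 2)^-1).
have d4 := is_derive_fM (is_derive_fcst (0 : R) (1 : R) c) (is_derive_fexpR d3).
by apply: (is_derive_eq d4); rewrite /=; field.
Qed.

Lemma is_derive_gaussian_dx i m s x : s != 0 ->
  is_derive x (unit_vec R i) (gaussian_dx i m s) (gaussian_dxx i m s x).
Proof.
move=> s0.
have dw := is_derive_coord x i.
have dg := is_derive_gaussian_pdf i m s x s0.
have d1 := is_derive_fD dw (is_derive_fcst x _ (- m ord0 i)).
have d2 := is_derive_fN (is_derive_fM d1 (is_derive_fcst x _ (s ^- 2))).
apply: (is_derive_eq (is_derive_fM d2 dg)).
by rewrite /gaussian_dx /gaussian_dxx; field.
Qed.

(* The factor (1 + v) e^(-v) <= 1 absorbs the quadratic weight w^2. *)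
Lemma gaussian_pdf_quadratic_decay i m s x : s != 0 ->
  (x ord0 i - m ord0 i) ^+ 2 * gaussian_pdf m s x <=
  2 * s ^+ 2 * (Num.sqrt (2 * pi * s ^+ 2)) ^- d.
Proof.
move=> s0; rewrite /gaussian_pdf mulrCA [leRHS]mulrC.
apply: ler_wpM2l; first by rewrite invr_ge0 exprn_ge0// sqrtr_ge0.
set w := x ord0 i - m ord0 i.
have s20 : 0 < 2 * s ^+ 2 by rewrite mulr_gt0// exprn_even_gt0.
rewrite mulNr expRN ler_pdivrMr ?expR_gt0// -ler_pdivrMl//.
apply: le_trans (expR_ge1Dx _).
rewrite mulrC (bigD1 i)//= [X in _ <= 1 + X]mulrDl -/w.
(* The other coordinates only enlarge the exponent $v$ in $1 + v \le e^v$. *)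
have : 0 <= (\sum_(j < d | j != i) (x ord0 j - m ord0 j) ^+ 2) / (2 * s ^+ 2).
  by rewrite divr_ge0// ?(ltW s20)// sumr_ge0// => j _; exact: sqr_ge0.
set a := w ^+ 2 / _; set b := _ / _; lra.
Qed.

(** Since $|w| \le 1 + w^2$, the linear weight is controlled by the peak height and the quadratic
    decay. The bound is uniform in [m] because the kernel is later integrated over its mean. *)
Lemma gaussian_dx_bounded i s : s != 0 ->
  exists C, forall m x, `|gaussian_dx i m s x| <= C.
Proof.
move=> s0; set c := (Num.sqrt (2 * pi * s ^+ 2)) ^- d.
exists (s ^- 2 * (c + 2 * s ^+ 2 * c)) => m x.
have := gaussian_pdf_quadratic_decay i m s x s0.
have := gaussian_pdf_le R d m s x; have := gaussian_pdf_ge0 R d m s x.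
rewrite /gaussian_dx -/c; set g := gaussian_pdf m s x; set w := _ - m ord0 i.
move=> g0 gc wc.
rewrite normrM normrN normrM (ger0_norm g0) normfV (ger0_norm (sqr_ge0 s)).
rewrite mulrAC [leLHS]mulrC ler_wpM2l ?invr_ge0 ?sqr_ge0//.
apply: le_trans (lerD gc wc); rewrite -[X in X + _]mul1r -mulrDl ler_wpM2r//.
rewrite -[w ^+ 2]real_normK ?num_real//.
have := sqr_ge0 (`|w| - 1); have := normr_ge0 w; nra.
Qed.

Lemma gaussian_dxx_bounded i s : s != 0 ->
  exists C, forall m x, `|gaussian_dxx i m s x| <= C.
Proof.
move=> s0; set c := (Num.sqrt (2 * pi * s ^+ 2)) ^- d.
exists (s ^- 4 * (2 * s ^+ 2 * c) + s ^- 2 * c) => m x.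
have := gaussian_pdf_quadratic_decay i m s x s0.
have := gaussian_pdf_le R d m s x; have := gaussian_pdf_ge0 R d m s x.
rewrite /gaussian_dxx -/c; set g := gaussian_pdf m s x; set w := _ - m ord0 i.
move=> g0 gc wc; rewrite mulrBl (le_trans (ler_normB _ _))//.
have s2 : 0 <= s ^- 2 by rewrite invr_ge0 sqr_ge0.
have s4 : 0 <= s ^- 4 by rewrite invr_ge0 exprn_even_ge0.
have e1 : 0 <= w ^+ 2 / s ^+ 4 * g.
  by apply: mulr_ge0 => //; exact: mulr_ge0 (sqr_ge0 _) s4.
rewrite (ger0_norm e1) (ger0_norm (mulr_ge0 s2 g0)).
apply: lerD; last exact: ler_wpM2l.
by rewrite mulrAC mulrC ler_wpM2l.
Qed.

End gaussian_space_derivatives.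

(** * Lipschitz estimates for exponentials and products *)

Section factor_lipschitz.
Variable R : realType.

(** For $p \le q$, factor out $e^{-p}$ and use $1 - e^{p-q} \le q - p$. The exponentials are kept on
    the right so that their decay can later absorb polynomial growth. *)
Lemma expRN_lipschitz (p q : R) :
  `|expR (- p) - expR (- q)| <= `|p - q| * (expR (- p) + expR (- q)).
Proof.
wlog pq : p q / p <= q.
  move=> H; have [pq|/ltW qp] := leP p q; first exact: H.
  by rewrite distrC (distrC p) [X in _ * X]addrC; exact: H.
have ep := expR_gt0 (- p); have eq := expR_gt0 (- q).
rewrite ger0_norm ?subr_ge0 ?ler_expR ?lerN2//.
rewrite distrC ger0_norm ?subr_ge0//.
have -> : expR (- q) = expR (- p) * expR (p - q).
  by rewrite -expRD; congr expR; ring.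
have := expR_ge1Dx (p - q); have := expR_gt0 (p - q).
set e := expR (p - q); set E := expR (- p) in ep *; move=> e0 H.
have H1 : 1 - e <= q - p by lra.
have := ler_wpM2l (ltW ep) H1.
have : 0 <= (q - p) * (E * e).
  by rewrite !mulr_ge0// ?subr_ge0 ?(ltW ep) ?(ltW e0).
lra.
Qed.

(* Since b >= b0 > 0, the exponential controls every polynomial in y: this
   makes the Lipschitz constant uniform in y. *)
Lemma gaussian_factor_lipschitz (Z b0 : R) : 0 < b0 -> 0 <= Z ->
  exists K, 0 <= K /\ forall z z' b b' y,
    `|z| <= Z -> `|z'| <= Z -> b0 <= b <= Z -> b0 <= b' <= Z ->
    `|expR (- ((z - b * y) ^+ 2 / 2)) - expR (- ((z' - b' * y) ^+ 2 / 2))|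
      <= K * (`|z - z'| + `|b - b'|).
Proof.
move=> b00 Z0.
(* With $u = z - by$, one has $b_0|y| \le Z + |u|$, hence $b_0^2(1+|y|)^2 \le 2((b_0+Z)^2 + u^2)$.
   This is at most $2((b_0+Z)^2+2)(1+u^2/2)$, and $1+u^2/2 \le e^{u^2/2}$. *)
pose K0 := 2 * ((b0 + Z) ^+ 2 + 2) / b0 ^+ 2.
have K00 : 0 <= K0.
  by rewrite /K0 divr_ge0 ?sqr_ge0// mulr_ge0// addr_ge0// sqr_ge0.
have decay z b y : `|z| <= Z -> b0 <= b ->
    (1 + `|y|) ^+ 2 * expR (- ((z - b * y) ^+ 2 / 2)) <= K0.
  move=> zZ b0b; rewrite expRN ler_pdivrMr ?expR_gt0//.
  set u := z - b * y.
  have : K0 * (1 + u ^+ 2 / 2) <= K0 * expR (u ^+ 2 / 2).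
    by rewrite ler_wpM2l// expR_ge1Dx.
  apply: le_trans.
  have by_ : b0 * `|y| <= Z + `|u|.
    apply: (@le_trans _ _ (`|b * y|)).
      by rewrite normrM ler_wpM2r// (le_trans b0b)// ler_norm.
    have -> : b * y = z - u by rewrite /u; ring.
    by apply: le_trans (ler_normB _ _) _; rewrite lerD2r.
  have h1 : (b0 * (1 + `|y|)) ^+ 2 <= (b0 + Z + `|u|) ^+ 2.
    rewrite ler_sqr ?nnegrE; first by lra.
      by rewrite mulr_ge0 ?(ltW b00)// addr_ge0.
    by rewrite !addr_ge0// ltW.
  have h2 : (b0 + Z + `|u|) ^+ 2 <= 2 * ((b0 + Z) ^+ 2 + u ^+ 2).
    rewrite -[u ^+ 2]real_normK ?num_real//.
    have := sqr_ge0 (b0 + Z - `|u|); nra.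
  have h3 : 2 * ((b0 + Z) ^+ 2 + u ^+ 2) <=
      2 * ((b0 + Z) ^+ 2 + 2) * (1 + u ^+ 2 / 2).
    have := sqr_ge0 u; have := sqr_ge0 (b0 + Z).
    set A := (b0 + Z) ^+ 2; set B := u ^+ 2; nra.
  rewrite /K0 mulrAC ler_pdivlMr ?exprn_gt0//.
  by rewrite mulrC -exprMn (le_trans h1)// (le_trans h2).
exists (2 * Z * K0); split; first by apply: mulr_ge0 => //; exact: mulr_ge0.
move=> z z' b b' y zZ z'Z /andP[b0b bZ] /andP[b0b' b'Z].
apply: le_trans (expRN_lipschitz _ _) _.
set E := expR _; set E' := expR _.
have dE := decay _ _ y zZ b0b; have dE' := decay _ _ y z'Z b0b'.
have Y0 := normr_ge0 y.
pose u := z - b * y; pose u' := z' - b' * y.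
(* As a difference of squares, one factor carries the increments and the other is bounded; each
   costs one power of $1+|y|$. *)
have -> : (z - b * y) ^+ 2 / 2 - (z' - b' * y) ^+ 2 / 2 =
  (z - z' - (b - b') * y) * (u + u') / 2 by rewrite /u /u'; field.
have h1 : `|z - z' - (b - b') * y| <= (`|z - z'| + `|b - b'|) * (1 + `|y|).
  apply: le_trans (ler_normB _ _) _; rewrite normrM.
  have := normr_ge0 (z - z'); have := normr_ge0 (b - b').
  set A := `|z - z'|; set B := `|b - b'|; nra.
have bn : `|b| <= Z by rewrite ger0_norm// (le_trans (ltW b00)).
have bn' : `|b'| <= Z by rewrite ger0_norm// (le_trans (ltW b00)).
have h2 : `|u + u'| <= 2 * Z * (1 + `|y|).
  have : `|u| <= Z * (1 + `|y|).
    apply: le_trans (ler_normB _ _) _; rewrite normrM mulrDr mulr1 lerD//.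
    exact: ler_wpM2r.
  have : `|u'| <= Z * (1 + `|y|).
    apply: le_trans (ler_normB _ _) _; rewrite normrM mulrDr mulr1 lerD//.
    exact: ler_wpM2r.
  have := ler_normD u u'; lra.
rewrite !normrM (@ger0_norm _ 2^-1) ?invr_ge0//.
have h3 := ler_pM (normr_ge0 _) (normr_ge0 _) h1 h2.
have EE : 0 <= E + E' by rewrite addr_ge0// expR_ge0.
have D0 : 0 <= `|z - z'| + `|b - b'| by rewrite addr_ge0.
move: h3 dE dE' EE D0; rewrite -/E -/E'.
set A := _ * `|u + u'|; set D := `|z - z'| + _; set Y := 1 + `|y|.
move=> h3 dE dE' EE D0.
have e1 : A * 2^-1 * (E + E') <= D * Y * (2 * Z * Y) * 2^-1 * (E + E').
  by rewrite ler_wpM2r// ler_wpM2r// invr_ge0.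
apply: le_trans e1 _.
(* The weight $Y^2$ is distributed over the two exponentials, and [decay] bounds each product by
   [K0]. *)
have -> : D * Y * (2 * Z * Y) * 2^-1 * (E + E') =
  Z * D * (Y ^+ 2 * E + Y ^+ 2 * E') by field.
have -> : 2 * Z * K0 * D = Z * D * (K0 + K0) by ring.
by rewrite ler_wpM2l ?mulr_ge0// lerD.
Qed.

(** Telescoping: one factor is changed at a time, and the remaining ones lie in $[0,1]$. *)
Lemma prod_lipschitz n (a b : 'I_n -> R) :
  (forall i, 0 <= a i <= 1) -> (forall i, 0 <= b i <= 1) ->
  `|\prod_(i < n) a i - \prod_(i < n) b i| <= \sum_(i < n) `|a i - b i|.
Proof.
elim: n a b => [|n IH] a b a01 b01; first by rewrite !big_ord0 subrr normr0.
rewrite !big_ord_recl.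
set A := \prod_(i < n) _; set B := \prod_(i < n) _.
have -> : a ord0 * A - b ord0 * B = (a ord0 - b ord0) * A + b ord0 * (A - B).
  by ring.
apply: le_trans (ler_normD _ _) _; apply: lerD.
  rewrite normrM ler_piMr// ger0_norm; last first.
    by apply: prodr_ge0 => i _; case/andP: (a01 (lift ord0 i)).
  by apply: prodr_ile1 => i _; exact: a01.
rewrite normrM; apply: (@le_trans _ _ `|A - B|).
  have /andP[b0 b1] := b01 ord0.
  by rewrite ler_piMl// ger0_norm.
by apply: IH => i.
Qed.

(** Near [t] the difference quotient is within 1 of the derivative, whence the constant [|k| + 1].
    One endpoint stays at [t], so derivability at that single point is enough. *)
Lemma derivable_lipschitz_at (f : R -> R) (t l : R) : is_derive t 1 f l ->
  exists L, 0 <= L /\ \forall s \near t, `|f s - f t| <= L * `|s - t|.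
Proof.
move=> [/cvg_ex[k fk] _].
exists (`|k| + 1); split; first by rewrite addr_ge0.
have /cvgrPdist_le/(_ 1 ltr01)[e /= e0 H] := fk.
exists e => // s /= ts.
have [->|st] := eqVneq s t; first by rewrite !subrr !normr0 mulr0.
have st0 : s - t != 0 by rewrite subr_eq0.
have := H (s - t); rewrite /= sub0r normrN distrC => /(_ ts st0).
rewrite scaler1 subrK => h.
have : `|(s - t)^-1 *: (f s - f t)| <= `|k| + 1.
  rewrite -[X in `|X|](subKr k) (le_trans (ler_normB _ _))// lerD2l.
  exact: h.
by rewrite /GRing.scale/= normrM normfV ler_pdivrMl ?normr_gt0// mulrC
  (distrC t).
Qed.

End factor_lipschitz.

(** * Time derivative and Lipschitz bound of the Gaussian kernel *)

Section gaussian_time.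
Variables (R : realType) (d : nat).
Implicit Types (x y : 'rV[R]_d).

(** Each factor has the shape $e^{-(z-by)^2/2}$ with $z = x_i/s$ and $b = a/s$, to which
    [gaussian_factor_lipschitz] applies. *)
Lemma gaussian_pdf_factor (a s : R) x y : 0 < s ->
  gaussian_pdf (a *: y) s x = (Num.sqrt (2 * pi) * s) ^- d *
    \prod_(i < d) expR (- ((x ord0 i * s^-1 - a * s^-1 * y ord0 i) ^+ 2 / 2)).
Proof.
move=> s0; rewrite /gaussian_pdf sqrt_2pi_sqr ?(ltW s0)//; congr (_ * _).
rewrite -expR_sum; congr expR; rewrite mulNr sumrN; congr (- _).
rewrite mulr_suml; apply: eq_bigr => i _; rewrite !mxE.
by field; rewrite gt_eqF.
Qed.

Variables (alpha sigma : R -> R) (t da ds : R).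
Hypotheses (alphaD : is_derive t 1 alpha da) (sigmaD : is_derive t 1 sigma ds).
Hypotheses (alpha0 : 0 < alpha t) (sigma0 : 0 < sigma t).

Let sigma_near : \forall s \near t, 0 < sigma s.
Proof.
have /cvgr_gt : sigma s @[s --> t] --> sigma t.
  by apply/differentiable_continuous/derivable1_diffP; case: sigmaD.
exact.
Qed.

Let peak (s : R) : R := (Num.sqrt (2 * pi) * sigma s) ^- d.

Let peakD : is_derive t 1 peak (- (d%:R * ds / sigma t) * peak t).
Proof.
have c0 := sqrt_2pi_gt0 R.
have d1 := is_derive_fM
  (is_derive_fcst (t : R) (1 : R) (Num.sqrt (2 * pi))) sigmaD.
have d2 := is_derive_fX d d1.
have cs0 : Num.sqrt (2 * pi) * sigma t != 0 by rewrite mulf_neq0 ?gt_eqF.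
have d3 := @is_derive_fV R t (fun s => (Num.sqrt (2 * pi) * sigma s) ^+ d) _
  (expf_neq0 d cs0) d2.
apply: (is_derive_eq d3); rewrite /peak /=.
(* The power rule produces the exponent [d.-1], so dimension 0 is treated apart. *)
case: d => [|n]; first by rewrite /=; ring.
rewrite /= (exprS _ n); have := expf_neq0 n cs0; set q := (_ * _) ^+ n => q0.
by field; rewrite q0 !gt_eqF.
Qed.

(** The right-hand side is that of the Fokker-Planck equation for the kernel, coordinate by
    coordinate: $-f\,p - f x_i\,\partial_i p + \tfrac12 g^2\,\partial_i^2 p$ with $f =
    \dot\alpha/\alpha$ and $\tfrac12 g^2 = \sigma\dot\sigma - f\sigma^2$. *)
Lemma gaussian_pdf_time_derivative x y :
  is_derive t 1 (fun s => gaussian_pdf (alpha s *: y) (sigma s) x)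
   (\sum_(i < d)
      (- (da / alpha t) * gaussian_pdf (alpha t *: y) (sigma t) x
       - (da / alpha t) * x ord0 i
           * gaussian_dx R d i (alpha t *: y) (sigma t) x
       + (sigma t * ds - (da / alpha t) * sigma t ^+ 2)
           * gaussian_dxx R d i (alpha t *: y) (sigma t) x)).
Proof.
pose w i s := x ord0 i - alpha s * y ord0 i.
pose E s := expR (- (\sum_(i < d) w i s ^+ 2) / (2 * sigma s ^+ 2)).
(* Pulling [sigma s] out of the square root requires its positivity, which is known only near
   [t]. *)
have near_E : \forall s \near t,
    peak s * E s = gaussian_pdf (alpha s *: y) (sigma s) x.
  apply: filterS sigma_near => s s0.
  rewrite /gaussian_pdf sqrt_2pi_sqr ?(ltW s0)//.
  by under [in RHS]eq_bigr do rewrite mxE.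
apply: (near_eq_is_derive near_E).
have dw i : is_derive t 1 (w i) (- (da * y ord0 i)).
  have := is_derive_fD (is_derive_fcst (t : R) (1 : R) (x ord0 i)) (is_derive_fN
   (is_derive_fM alphaD (is_derive_fcst (t : R) (1 : R) (y ord0 i)))).
  by move/is_derive_eq; apply; rewrite mulr0 addr0 add0r.
have dS := is_derive_fsum (fun i => is_derive_fX 2 (dw i)).
have dV := is_derive_fM (is_derive_fcst (t : R) (1 : R) 2)
  (is_derive_fX 2 sigmaD).
have s20 : 2 * sigma t ^+ 2 != 0 by rewrite mulf_neq0// expf_neq0// gt_eqF.
have dE := is_derive_fexpR (is_derive_fM (is_derive_fN dS)
  (@is_derive_fV R t (fun s => 2 * sigma s ^+ 2) _ s20 dV)).
apply: (is_derive_eq (is_derive_fM peakD dE)) => /=.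
have gE : gaussian_pdf (alpha t *: y) (sigma t) x = peak t * E t.
  by rewrite (nbhs_singleton near_E).
(* Contribution of coordinate [i] to the logarithmic time derivative of the kernel. *)
pose T i := - (ds / sigma t) + (da / sigma t ^+ 2) * (w i t * y ord0 i)
   + (ds / sigma t ^+ 3) * w i t ^+ 2.
transitivity (\sum_(i < d) T i * (peak t * E t)); last first.
  apply: eq_bigr => i _; rewrite /gaussian_dx /gaussian_dxx gE /T /w !mxE.
  by field; rewrite !gt_eqF.
rewrite -mulr_suml /T !big_split/= sumr_const card_ord -!mulr_sumr.
rewrite (_ : \sum_(i < d) (2 * w i t ^+ 1 * - (da * y ord0 i)) =
    - (2 * da) * \sum_(i < d) w i t * y ord0 i); last first.
  by rewrite mulr_sumr; apply: eq_bigr => i _; ring.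
rewrite -[X in _ = (X + _ + _) * _]mulr_natr /E.
set e := expR _; set S := \sum_(i < d) w i t ^+ 2; set P := \sum_(i < d) _ * _.
by field; rewrite gt_eqF.
Qed.

Lemma gaussian_pdf_time_lipschitz x : exists C, \forall s \near t, forall y,
  `|gaussian_pdf (alpha s *: y) (sigma s) x
    - gaussian_pdf (alpha t *: y) (sigma t) x| <= C * `|s - t|.
Proof.
have dsV := @is_derive_fV R t sigma _ (lt0r_neq0 sigma0) sigmaD.
have dz i := is_derive_fM (is_derive_fcst (t : R) (1 : R) (x ord0 i)) dsV.
have db := is_derive_fM alphaD dsV.
pose z i s := x ord0 i * (sigma s)^-1.
pose b s := alpha s * (sigma s)^-1.
have [Lb [Lb0 nb]] := derivable_lipschitz_at _ _ _ _ db.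
have [Lp [Lp0 np]] := derivable_lipschitz_at _ _ _ _ peakD.
have bt0 : 0 < b t by rewrite divr_gt0.
have cts (f : R -> R) l : is_derive t 1 f l -> f s @[s --> t] --> f t.
  by move=> [D _]; apply/differentiable_continuous/derivable1_diffP.
pose e (i : 'I_d) (s y : R) : R := expR (- ((z i s - b s * y) ^+ 2 / 2)).
have He i : exists C, 0 <= C /\ \forall s \near t, forall y : R,
    `|e i s y - e i t y| <= C * `|s - t|.
  have [Lz [Lz0 nz]] := derivable_lipschitz_at _ _ _ _ (dz i).
  (* For [s] near [t], [z i s] moves by less than 1 and [b s] by less than [b t / 2]; hence [Z]
     bounds both from above and [b t / 2] bounds [b s] from below. *)
  pose Z := `|z i t| + 2 * b t + 1.
  have Z0 : 0 <= Z by have := normr_ge0 (z i t); rewrite /Z; lra.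
  have [|K [K0 HK]] := @gaussian_factor_lipschitz R Z (b t / 2) _ Z0.
    by rewrite divr_gt0.
  exists (K * (Lz + Lb)); split; first by rewrite mulr_ge0// addr_ge0.
  near=> s => y.
  have zs : `|z i s - z i t| <= Lz * `|s - t| by near: s; exact: nz.
  have bs : `|b s - b t| <= Lb * `|s - t| by near: s; exact: nb.
  apply: le_trans (HK _ _ _ _ _ _ _ _ _) _.
  - have : `|z i t - z i s| < 1.
      by near: s; move/cvgrPdist_lt : (cts _ _ (dz i)); apply.
    rewrite distrC => H; rewrite -[z i s](subrK (z i t)).
    apply: le_trans (ler_normD _ _) _; rewrite /Z; lra.
  - by rewrite /Z; lra.
  - have : `|b t - b s| < b t / 2.
      by near: s; move/cvgrPdist_lt : (cts _ _ db); apply; rewrite divr_gt0.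
    rewrite ltr_norml => /andP[H1 H2]; have := normr_ge0 (z i t).
    by move=> H3; apply/andP; split; rewrite /Z; lra.
  - have := normr_ge0 (z i t).
    by move=> H3; apply/andP; split; rewrite /Z; lra.
  rewrite -mulrA ler_wpM2l// mulrDl lerD//.
have /choice[C HC] := He.
exists (Lp + `|peak t| * \sum_(i < d) C i).
near=> s => y.
have s0 : 0 < sigma s by near: s.
rewrite !gaussian_pdf_factor// -!/(peak _).
set A := \prod_(i < d) _; set B := \prod_(i < d) _.
have e01 i r u : 0 <= e i r u <= 1.
  by rewrite expR_ge0/= -[leRHS]expR0 ler_expR oppr_le0 divr_ge0// sqr_ge0.
have A1 : `|A| <= 1.
  rewrite ger0_norm; last by apply: prodr_ge0 => i _; exact: expR_ge0.
  by apply: prodr_ile1 => i _; exact: (e01 i s (y ord0 i)).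
have AB : `|A - B| <= (\sum_(i < d) C i) * `|s - t|.
  apply: le_trans (prod_lipschitz _ _ _ _ _ _) _.
  - by move=> i; exact: (e01 i s (y ord0 i)).
  - by move=> i; exact: (e01 i t (y ord0 i)).
  rewrite mulr_suml; apply: ler_sum => i _.
  (* The coordinate of [y] is generalised before the neighbourhood is chosen, which keeps the latter
     independent of [y]; finitely many neighbourhoods, one per [i], are intersected. *)
  move: i (y ord0 i); near: s; apply: filter_forall => i.
  exact: (HC i).2.
have -> : peak s * A - peak t * B = (peak s - peak t) * A + peak t * (A - B).
  by ring.
apply: le_trans (ler_normD _ _) _; rewrite !normrM mulrDl; apply: lerD.
- rewrite -[leRHS]mulr1 ler_pM//; near: s; exact: np.
- by rewrite -mulrA ler_wpM2l.
Unshelve. all: end_near. Qed.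

End gaussian_time.

(** * Gaussian mixtures *)

Lemma Rintegral_sum d (Y : measurableType d) (R : realType)
    (mu : {measure set Y -> \bar R}) n (F : 'I_n -> Y -> R) :
  (forall i, mu.-integrable setT (EFin \o F i)) ->
  \int[mu]_y (\sum_(i < n) F i y) = \sum_(i < n) \int[mu]_y F i y.
Proof.
move=> intF; rewrite /Rintegral.
under eq_integral do rewrite -sumEFin.
rewrite (integral_sum measurableT intF) sum_fine// => i _.
exact: (integrable_fin_num measurableT (intF i)).
Qed.

(** * The Fokker-Planck equation for Gaussian mixtures *)

Section mixture_fokker_planck.
Variables (R : realType) (d : nat).
Variable mu : {finite_measure set 'rV[R]_d -> \bar R}.
Implicit Types (x y : 'rV[R]_d).

Lemma measurable_row_scale (a : R) :
  measurable_fun setT (fun y : 'rV[R]_d => a *: y).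
Proof.
have := measurable_row_affine R d 0 a.
by under eq_fun do rewrite add0r.
Qed.

Lemma integrable_gaussian_pdf (a s : R) x :
  mu.-integrable setT (fun y => (gaussian_pdf (a *: y) s x)%:E).
Proof.
apply: (bounded_integrable _ _ _ _ _ ((Num.sqrt (2 * pi * s ^+ 2)) ^- d)).
  by apply: measurable_gaussian_pdf => //; exact: measurable_row_scale.
by move=> y; rewrite ger0_norm ?gaussian_pdf_ge0// gaussian_pdf_le.
Qed.

Let measurable_shift (a : R) x (i : 'I_d) :
  measurable_fun setT (fun y => x ord0 i - (a *: y) ord0 i).
Proof.
apply: measurable_funB => //.
exact: (measurableT_comp (@measurable_coord _ R _ i) (measurable_row_scale a)).
Qed.

Lemma integrable_gaussian_dx i (a s : R) x : s != 0 ->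
  mu.-integrable setT (fun y => (gaussian_dx R d i (a *: y) s x)%:E).
Proof.
move=> s0; have [C HC] := gaussian_dx_bounded R d i s s0.
apply: (bounded_integrable _ _ _ _ _ C) => //.
apply: measurable_funM.
  by apply: measurableT_comp => //; apply: measurable_funM.
by apply: measurable_gaussian_pdf => //; exact: measurable_row_scale.
Qed.

Lemma integrable_gaussian_dxx i (a s : R) x : s != 0 ->
  mu.-integrable setT (fun y => (gaussian_dxx R d i (a *: y) s x)%:E).
Proof.
move=> s0; have [C HC] := gaussian_dxx_bounded R d i s s0.
apply: (bounded_integrable _ _ _ _ _ C) => //.
apply: measurable_funM.
  apply: measurable_funB => //; apply: measurable_funM => //.
  exact: measurable_funX.
by apply: measurable_gaussian_pdf => //; exact: measurable_row_scale.
Qed.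

Variables (alpha sigma : R -> R) (t da ds : R).
Hypotheses (alphaD : is_derive t 1 alpha da) (sigmaD : is_derive t 1 sigma ds).
Hypotheses (alpha0 : 0 < alpha t) (sigma0 : 0 < sigma t).

(** All derivatives pass under the integral: those in [x] by uniform bounds, the one in [t] by the
    Lipschitz bound at [t]. The kernel equation is then integrated term by term. *)
Lemma gaussian_mixture_fokker_planck (f g : R -> R)
    (p : R -> 'rV[R]_d -> R) x :
  (forall s x, p s x = \int[mu]_y gaussian_pdf (alpha s *: y) (sigma s) x) ->
  f t = da / alpha t ->
  g t ^+ 2 = 2 * (sigma t * ds - (da / alpha t) * sigma t ^+ 2) ->
  fokker_planck (fun s y => f s *: y) g p t x.
Proof.
move=> pE fE gE.
have s0 : sigma t != 0 by rewrite gt_eqF.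
have ptE : p t = fun x => \int[mu]_y gaussian_pdf (alpha t *: y) (sigma t) x.
  by apply/funext => z; exact: pE.
pose px i z := \int[mu]_y gaussian_dx R d i (alpha t *: y) (sigma t) z.
pose pxx i z := \int[mu]_y gaussian_dxx R d i (alpha t *: y) (sigma t) z.
have Dx i z : is_derive z (unit_vec R i) (p t) (px i z).
  have [C HC] := gaussian_dx_bounded R d i _ s0.
  rewrite ptE; apply: (is_derive_integral_dir _ _ _ _ mu
    (fun z y => gaussian_pdf (alpha t *: y) (sigma t) z)
    (fun z y => gaussian_dx R d i (alpha t *: y) (sigma t) z) _ C).
  - by move=> u; exact: integrable_gaussian_pdf.
  - by move=> u y; exact: is_derive_gaussian_pdf.
  - by move=> u y; exact: HC.
have Dxx i z : is_derive z (unit_vec R i) (px i) (pxx i z).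
  have [C HC] := gaussian_dxx_bounded R d i _ s0.
  apply: (is_derive_integral_dir _ _ _ _ mu
    (fun z y => gaussian_dx R d i (alpha t *: y) (sigma t) z)
    (fun z y => gaussian_dxx R d i (alpha t *: y) (sigma t) z) _ C).
  - by move=> u; exact: integrable_gaussian_dx.
  - by move=> u y; exact: is_derive_gaussian_dx.
  - by move=> u y; exact: HC.
have DxE i : 'D_(unit_vec R i) (p t) = px i.
  by apply/funext => z; have [_] := Dx i z.
have [C HC] := gaussian_pdf_time_lipschitz R d alpha sigma t da ds alphaD
  sigmaD alpha0 sigma0 x.
have [_ Dt] := is_derive_integral _ _ _ mu
  (fun s y => gaussian_pdf (alpha s *: y) (sigma s) x) _ t C
  (fun s => integrable_gaussian_pdf (alpha s) (sigma s) x)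
  (fun y => gaussian_pdf_time_derivative R d alpha sigma t da ds alphaD
     sigmaD alpha0 sigma0 x y) HC.
have ptxE : (fun s => p s x) =
    fun s => \int[mu]_y gaussian_pdf (alpha s *: y) (sigma s) x.
  by apply/funext => s; exact: pE.
have Dflux i z : is_derive z (unit_vec R i)
    (fun y => (p t y *: (f t *: y)) ord0 i)
    (px i z * (f t * z ord0 i) + p t z * f t).
  under eq_fun do rewrite !mxE.
  have := is_derive_fM (Dx i z) (is_derive_fM
    (is_derive_fcst z (unit_vec R i) (f t)) (is_derive_coord R d z i)).
  by move/is_derive_eq; apply; rewrite mul0r add0r mulr1.
split.
- by rewrite ptxE; case: Dt.
- by move=> i; case: (Dflux i x).
- by move=> i y; case: (Dx i y).
- by move=> i; rewrite DxE; case: (Dxx i x).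
rewrite ptxE derive1E (@derive_val _ _ _ _ _ _ _ Dt).
have ip := integrable_gaussian_pdf (alpha t) (sigma t) x.
have ipx i := integrable_gaussian_dx i (alpha t) _ x s0.
have ipxx i := integrable_gaussian_dxx i (alpha t) _ x s0.
have Zint (c : R) (F : 'rV[R]_d -> R) : mu.-integrable setT (EFin \o F) ->
    mu.-integrable setT (EFin \o (fun y => c * F y)).
  by move=> /(integrableZl measurableT c); apply: eq_integrable.
have Dint (F G : 'rV[R]_d -> R) : mu.-integrable setT (EFin \o F) ->
    mu.-integrable setT (EFin \o G) ->
    mu.-integrable setT (EFin \o (fun y => F y + G y)).
  by move=> iF iG; have := integrableD measurableT iF iG; apply: eq_integrable.
have Nint (F : 'rV[R]_d -> R) : mu.-integrable setT (EFin \o F) ->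
    mu.-integrable setT (EFin \o (fun y => - F y)).
  by move=> /integrableN; apply: eq_integrable.
have i1 := Zint (- (da / alpha t)) _ ip.
have i2 i := Zint (da / alpha t * x ord0 i) _ (ipx i).
have i3 i := Zint (sigma t * ds - da / alpha t * sigma t ^+ 2) _ (ipxx i).
have i12 i := Dint _ _ i1 (Nint _ (i2 i)).
rewrite Rintegral_sum; last by move=> i; exact: (Dint _ _ (i12 i) (i3 i)).
have -> : laplacian (p t) x = \sum_(i < d) pxx i x.
  by apply: eq_bigr => i _; rewrite DxE; have [_] := Dxx i x.
have -> : divergence (fun y => p t y *: (f t *: y)) x =
    \sum_(i < d) (px i x * (f t * x ord0 i) + p t x * f t).
  by apply: eq_bigr => i _; have [_] := Dflux i x.
(* Divergence, Laplacian and time derivative are all sums over coordinates, so the equation is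
   checked for each [i]. *)
rewrite gE mulr_sumr -sumrN -big_split/=; apply: eq_bigr => i _.
rewrite (RintegralD measurableT (i12 i) (i3 i)).
rewrite (RintegralB measurableT i1 (i2 i)).
rewrite (RintegralZl _ measurableT ip) (RintegralZl _ measurableT (ipx i)).
rewrite (RintegralZl _ measurableT (ipxx i)) pE fE -/(px i x) -/(pxx i x).
by field; rewrite gt_eqF.
Qed.

End mixture_fokker_planck.

(** * Normalisation and initial law of Gaussian mixtures *)

Section mixture.
Variables (R : realType) (d : nat).
Variable mu : probability 'rV[R]_d R.
Local Notation lambda := (lebesgue_row R d).
Local Notation gamma := (gaussian_pdf (0 : 'rV[R]_d) 1).

Let measurable_kernel (a s : R) : measurable_fun setT
  (fun z : 'rV[R]_d * 'rV[R]_d => (gaussian_pdf (a *: z.2) s z.1)%:E).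
Proof.
apply/measurable_EFinP/measurable_gaussian_pdf => //.
exact: (measurableT_comp (measurable_row_scale R d a)).
Qed.

Let kernel_ge0 (a s : R) (z : 'rV[R]_d * 'rV[R]_d) :
  (0 <= (gaussian_pdf (a *: z.2) s z.1)%:E)%E.
Proof. by rewrite lee_fin gaussian_pdf_ge0. Qed.

Lemma measurable_gaussian_mixture (a s : R) : measurable_fun setT
  (fun x : 'rV[R]_d => \int[mu]_y gaussian_pdf (a *: y) s x).
Proof.
apply: (@measurableT_comp _ _ _ _ _ _ fine _
  (fun x => \int[mu]_y (gaussian_pdf (a *: y) s x)%:E)%E) => //.
exact: (measurable_fun_fubini_tonelli_F _ (measurable_kernel a s)
  (kernel_ge0 a s)).
Qed.

Lemma EFin_gaussian_mixture (a s : R) x :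
  (\int[mu]_y gaussian_pdf (a *: y) s x)%:E =
  (\int[mu]_y (gaussian_pdf (a *: y) s x)%:E)%E.
Proof.
rewrite /Rintegral fineK//; apply: integrable_fin_num => //.
exact: integrable_gaussian_pdf.
Qed.

(** By Tonelli, total mass one follows from that of each kernel and of [mu]. *)
Lemma gaussian_mixture_density (a s : R) : 0 < s ->
  probability_density
    (fun x : 'rV[R]_d => \int[mu]_y gaussian_pdf (a *: y) s x).
Proof.
move=> s0; split.
- exact: measurable_gaussian_mixture.
- by move=> x; apply: Rintegral_ge0 => y _; exact: gaussian_pdf_ge0.
under eq_integral do rewrite EFin_gaussian_mixture.
rewrite (fubini_tonelli _ (measurable_kernel a s))//=.
under eq_integral do rewrite integral_gaussian_pdf//.
rewrite integral_cst// mul1e; exact: probability_setT.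
Qed.

Let measurable_comb (a s : R) : measurable_fun setT
  (fun z : 'rV[R]_d * 'rV[R]_d => a *: z.1 + s *: z.2).
Proof.
apply: measurable_fun_rowP => i; under eq_fun do rewrite !mxE.
by apply: measurable_funD; apply: measurable_funM => //;
  exact: (measurableT_comp (@measurable_coord _ R _ i)).
Qed.

Let measurable_integrand (psi : 'rV[R]_d -> R) (a s : R) :
  measurable_fun setT psi -> measurable_fun setT
  (fun z : 'rV[R]_d * 'rV[R]_d => psi (a *: z.1 + s *: z.2) * gamma z.2).
Proof.
move=> mpsi; apply: measurable_funM.
  exact: (measurableT_comp mpsi (measurable_comb a s)).
exact: measurable_gaussian_pdf.
Qed.

(** Tonelli exchanges the integrals, then $x = ay + sz$ is substituted for each fixed $y$. The right
    side is the expectation of $\psi(aX_0 + sZ)$ with $Z$ standard normal independent of $X_0$. *)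
Lemma integral_gaussian_mixture (psi : 'rV[R]_d -> R) (a s : R) :
  0 < s -> measurable_fun setT psi -> (forall x, 0 <= psi x) ->
  (\int[lambda]_x (psi x * \int[mu]_y gaussian_pdf (a *: y) s x)%R%:E =
   \int[mu \x lambda]_z (psi (a *: z.1 + s *: z.2) * gamma z.2)%:E)%E.
Proof.
move=> s0 mpsi psi0.
have mk : measurable_fun setT (fun z : 'rV[R]_d * 'rV[R]_d =>
    (psi z.1 * gaussian_pdf (a *: z.2) s z.1)%:E).
  apply/measurable_EFinP/measurable_funM; first exact: (measurableT_comp mpsi).
  by move/measurable_EFinP : (measurable_kernel a s).
rewrite fubini_tonelli1; last 2 first.
- by apply/measurable_EFinP; exact: measurable_integrand.
- by move=> z; rewrite lee_fin mulr_ge0// gaussian_pdf_ge0.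
rewrite /fubini_F /=.
under [RHS]eq_integral do rewrite -integral_gaussian_affine//.
rewrite -(fubini_tonelli _ mk); last first.
  by move=> z; rewrite lee_fin mulr_ge0// gaussian_pdf_ge0.
apply: eq_integral => x _ /=.
rewrite EFinM EFin_gaussian_mixture -ge0_integralZl//.
- apply/measurable_EFinP/measurable_gaussian_pdf => //.
  exact: measurable_row_scale.
- by move=> y _; rewrite lee_fin gaussian_pdf_ge0.
- by rewrite lee_fin.
Qed.

(** Dominated convergence on the product space, with dominating function [M * gamma z.2] of integral
    [M]; the limit is written on the same space because [gamma] has mass one. *)
Lemma cvg_gaussian_perturbation (psi : 'rV[R]_d -> R) (M : R) (a s : R^nat) :
  continuous psi -> (forall x, 0 <= psi x) -> (forall x, psi x <= M) ->
  a @ \oo --> (1 : R) -> s @ \oo --> (0 : R) ->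
  (\int[mu \x lambda]_z (psi (a n *: z.1 + s n *: z.2) * gamma z.2)%:E
     @[n --> \oo] --> \int[mu]_y (psi y)%:E)%E.
Proof.
move=> cpsi psi0 psiM a1 s0.
have mpsi := continuous_measurable_row R d psi cpsi.
have M0 : 0 <= M by exact: le_trans (psi0 0) (psiM 0).
have mg : measurable_fun setT (fun z : 'rV[R]_d * 'rV[R]_d => gamma z.2).
  exact: measurable_gaussian_pdf.
have mpg : measurable_fun setT
    (fun z : 'rV[R]_d * 'rV[R]_d => (psi z.1 * gamma z.2)%:E).
  apply/measurable_EFinP/measurable_funM => //.
  exact: (measurableT_comp mpsi).
have -> : (\int[mu]_y (psi y)%:E =
    \int[mu \x lambda]_z (psi z.1 * gamma z.2)%:E)%E.
  rewrite fubini_tonelli1//; last first.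
    by move=> z; rewrite lee_fin mulr_ge0// gaussian_pdf_ge0.
  apply: eq_integral => y _; rewrite /fubini_F /=.
  under eq_integral do rewrite EFinM.
  rewrite ge0_integralZl//; first by rewrite integral_gaussian_pdf// mule1.
  - by apply/measurable_EFinP; exact: measurable_gaussian_pdf.
  - by move=> z _; rewrite lee_fin gaussian_pdf_ge0.
  - by rewrite lee_fin.
have [|||||_ _ cv] := @dominated_convergence _ _ _ (mu \x lambda)%E _
  measurableT
  (fun n z => (psi (a n *: z.1 + s n *: z.2) * gamma z.2)%:E)
  (fun z => (psi z.1 * gamma z.2)%:E) (fun z => (M * gamma z.2)%:E).
- by move=> n; apply/measurable_EFinP; exact: measurable_integrand.
- exact: mpg.
- apply: aeW => z _; apply: cvg_EFin; first exact: nearW.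
  apply: cvgM; last exact: cvg_cst.
  have : a n *: z.1 + s n *: z.2 @[n --> \oo] --> z.1.
    rewrite (_ : nbhs z.1 = nbhs ((1 : R) *: z.1 + (0 : R) *: z.2)); last first.
      by rewrite scale1r scale0r addr0.
    by apply: cvgD; apply: cvgZr_tmp.
  by move=> /cvg_comp; apply; exact: cpsi.
- apply/integrable12ltyP; first by apply/measurable_EFinP/measurable_funM.
  rewrite (eq_integral (cst M%:E)).
    rewrite integral_cst// [X in (_ * X)%E](_ : _ = 1%E) ?mule1 ?ltry//.
    exact: probability_setT.
  move=> y _ /=.
  under eq_integral do rewrite ger0_norm ?mulr_ge0 ?gaussian_pdf_ge0// EFinM.
  rewrite ge0_integralZl//; first by rewrite integral_gaussian_pdf// mule1.
  - by apply/measurable_EFinP; exact: measurable_gaussian_pdf.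
  - by move=> z _; rewrite lee_fin gaussian_pdf_ge0.
- apply: aeW => z n _; rewrite lee_fin ger0_norm; last first.
    by rewrite mulr_ge0// gaussian_pdf_ge0.
  by rewrite ler_wpM2r// gaussian_pdf_ge0.
exact: cv.
Qed.

Lemma gaussian_mixture_initial_law (alpha sigma : R -> R)
    (p : R -> 'rV[R]_d -> R) :
  (forall s x, p s x = \int[mu]_y gaussian_pdf (alpha s *: y) (sigma s) x) ->
  (forall t, 0 < t < 1 -> 0 < sigma t) ->
  alpha x @[x --> 0^'+] --> (1 : R) -> sigma x @[x --> 0^'+] --> (0 : R) ->
  has_initial_law p mu.
Proof.
move=> pE sigma0 alpha1 sigma0_ phi cphi [M phiM].
(* The Tonelli identity needs a nonnegative integrand. The shift by [M] is undone at the end, since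
   [p t] and [mu] both have mass one. *)
pose psi x := phi x + M.
have psi0 x : 0 <= psi x by have := phiM x; rewrite ler_norml /psi; lra.
have psiM x : psi x <= 2 * M by have := phiM x; rewrite ler_norml /psi; lra.
have cpsi : continuous psi by move=> x; exact: (cvgD (cphi x) (cvg_cst M)).
have mphi := continuous_measurable_row R d phi cphi.
have mpsi := continuous_measurable_row R d psi cpsi.
pose A t := (\int[mu \x lambda]_z
  (psi (alpha t *: z.1 + sigma t *: z.2) * gamma z.2)%:E)%E.
have ipsi : mu.-integrable setT (EFin \o psi).
  by apply: (bounded_integrable _ _ _ _ _ (2 * M)) => // y; rewrite ger0_norm.
have iphi : mu.-integrable setT (EFin \o phi).
  by apply: (bounded_integrable _ _ _ _ _ M) => // y.
have cvA : fine (A t) @[t --> 0^'+] --> \int[mu]_y psi y.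
  (* Dominated convergence concerns sequences, so the right limit is tested along sequences of
     positive times. *)
  apply/cvg_at_rightP => u [u0 cu]; apply: fine_cvg.
  rewrite fineK; last exact: (integrable_fin_num measurableT ipsi).
  apply: (cvg_gaussian_perturbation _ (2 * M)) => //.
  - by move/cvg_at_rightP : alpha1; exact.
  - by move/cvg_at_rightP : sigma0_; exact.
have -> : \int[mu]_x phi x = \int[mu]_y psi y - M.
  rewrite /psi RintegralD//; last exact: finite_measure_integrable_cst.
  rewrite Rintegral_cst// (_ : fine _ = 1) ?mulr1 ?addrK//.
  by rewrite -[RHS]/(fine 1%E); congr fine; exact: probability_setT.
apply: (@cvg_trans _ ((fun t => fine (A t) - M) @ 0^'+)); last first.
  by apply: cvgB => //; exact: cvg_cst.
apply: near_eq_cvg; near=> t.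
have t01 : 0 < t < 1.
  by apply/andP; split; near: t; [exact: nbhs_right_gt|exact: nbhs_right_lt].
have st0 := sigma0 _ t01.
have ptE : p t = fun x => \int[mu]_y gaussian_pdf (alpha t *: y) (sigma t) x.
  by apply/funext => x; exact: pE.
have [mp p0 p1] : probability_density (p t).
  by rewrite ptE; exact: gaussian_mixture_density.
have ip : lambda.-integrable setT (EFin \o p t).
  apply/integrableP; split; first exact/measurable_EFinP.
  rewrite (eq_integral (fun x => (p t x)%:E)); first by rewrite p1 ltry.
  by move=> x _; rewrite /= ger0_norm.
have ippsi : lambda.-integrable setT (EFin \o (fun x => psi x * p t x)).
  apply: (@le_integrable _ _ _ _ _ measurableT _
    (EFin \o (fun x => 2 * M * p t x))).
  - apply/measurable_EFinP; exact: (measurable_funM mpsi mp).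
  - move=> x _ /=; rewrite lee_fin !normrM (ger0_norm (psi0 x)) ler_wpM2r//.
    by rewrite -normrM; apply: le_trans (psiM x) _; exact: ler_norm.
  by have := integrableZl measurableT (2 * M) ip; apply: eq_integrable.
have iMp : lambda.-integrable setT (EFin \o (fun x => M * p t x)).
  by have := integrableZl measurableT M ip; apply: eq_integrable.
have -> : fine (A t) = \int[lambda]_x (psi x * p t x).
  rewrite /A -integral_gaussian_mixture//; congr fine.
  by apply: eq_integral => x _; rewrite pE.
transitivity (\int[lambda]_x (psi x * p t x - M * p t x)); last first.
  by apply: eq_Rintegral => x _; rewrite /psi; ring.
rewrite RintegralB// RintegralZl//; congr (_ - _).
by rewrite /Rintegral p1 mulr1.
Unshelve. all: end_near. Qed.

End mixture.

(** * Consequences of differentiability on $[0,1]$ *)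

Section schedule.
Variable R : realType.

Lemma differentiable_on01_derivable (h : R -> R) (t : R) :
  differentiable_on01 h -> 0 < t < 1 -> derivable h t 1.
Proof.
move=> dh t01; have /andP[t0 t1] := t01.
have /dh/cvg_ex[l hl] : 0 <= t <= 1 by rewrite !ltW.
apply/cvg_ex; exists l; apply/cvgrPdist_le => e e0.
move/cvgrPdist_le : hl => /(_ e e0)[r /= r0 H].
(* Increments smaller than [t] and [1 - t] stay in $[0,1]$, where the restricted limit is the
   ordinary one. *)
exists (Num.min r (Num.min t (1 - t))) => /=.
  by rewrite !lt_min r0 t0 subr_gt0.
move=> k /=; rewrite sub0r normrN !lt_min => /and3P[kr kt kt1] k0.
rewrite scaler1 /GRing.scale/= mulrC.
have := H (k + t).
rewrite /= opprD addrCA subrr addr0 normrN addrK; apply => //.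
split; last by move=> /eqP; rewrite -subr_eq0 addrK (negbTE k0).
move: kt kt1; rewrite in_itv/= !ltr_norml => /andP[? ?] /andP[? ?].
by apply/andP; split; lra.
Qed.

(** Write $h(s) = h(0) + q(s)\,s$, where the one-sided quotient $q$ converges at 0. *)
Lemma differentiable_on01_cvg0 (h : R -> R) :
  differentiable_on01 h -> h t @[t --> 0^'+] --> h 0.
Proof.
move=> dh; have /dh/cvg_ex[l hl] : 0 <= (0 : R) <= 1 by rewrite lexx ler01.
have ql : (h s - h 0) / (s - 0) @[s --> 0^'+] --> l.
  apply: cvg_trans hl; apply: cvg_app => P [e /= e0 HP].
  exists (Num.min e 1) => /=; first by rewrite lt_min e0 ltr01.
  move=> s /=; rewrite sub0r normrN lt_min => /andP[se s1] s0.
  apply: HP; rewrite /= ?sub0r ?normrN//; split; last first.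
    by move=> s00; rewrite s00 ltxx in s0.
  by rewrite in_itv/= ltW//=; move: s1; rewrite gtr0_norm// => /ltW.
have : h 0 + (h s - h 0) / (s - 0) * s @[s --> 0^'+] --> h 0 + l * 0.
  apply: cvgD; first exact: cvg_cst.
  by apply: cvgM => //; apply: cvg_at_right_filter; exact: cvg_id.
rewrite mulr0 addr0; apply: cvg_trans; apply: near_eq_cvg; near=> s.
have s0 : 0 < s by near: s; exact: nbhs_right_gt.
by rewrite subr0 divfK ?gt_eqF// addrC subrK.
Unshelve. all: end_near. Qed.

End schedule.

Theorem theorem2p2 (R : realType) (d : nat)
    (disp : measure_display) (Omega : measurableType disp)
    (P : probability Omega R) (X0 : {RV P >-> 'rV[R]_d})
    (p0 : 'rV[R]_d -> R) (p0_density : has_density (distribution P X0) p0)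
    (alpha sigma : R -> R) (alpha_sigma : schedule alpha sigma)
    (g2_ge0 : forall t : R, 0 < t < 1 -> 0 <= g2_coef alpha sigma t) :
  generates
    (Sde (fun t x => f_coef alpha t *: x) (g_coef alpha sigma)
       (distribution P X0))
    (marginal_pdf alpha sigma p0)
  /\ (forall (t : R) (x : 'rV[R]_d), 0 < t < 1 ->
       derive1 (fun s => marginal_pdf alpha sigma p0 s x) t =
         - divergence
             (fun y => marginal_pdf alpha sigma p0 t y *: (f_coef alpha t *: y))
             x
         + 2^-1 * g_coef alpha sigma t ^+ 2
           * laplacian (marginal_pdf alpha sigma p0 t) x).
Proof.
pose mu : probability 'rV[R]_d R := distribution P X0.
have [mp0 p00 p0E] := p0_density.
(* Integration against [p0] becomes integration against the law of [X0], which brings the marginal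
   into mixture form. *)
have pE s x : marginal_pdf alpha sigma p0 s x =
    \int[mu]_y gaussian_pdf (alpha s *: y) (sigma s) x.
  rewrite /marginal_pdf /Rintegral /cond_pdf; congr fine.
  exact: (integral_density _ _ _ mu (lebesgue_row R d) _ _ mp0 p00 p0E
    (integrable_gaussian_pdf _ _ mu _ _ _)).
have [dalpha dsigma a0 _ s0 _ _ _ alpha0 sigma0] := alpha_sigma.
have FP t x : 0 < t < 1 -> fokker_planck (fun s y => f_coef alpha s *: y)
    (g_coef alpha sigma) (marginal_pdf alpha sigma p0) t x.
  move=> t01.
  have Da := derivableP (differentiable_on01_derivable _ _ _ dalpha t01).
  have Ds := derivableP (differentiable_on01_derivable _ _ _ dsigma t01).
  apply: (gaussian_mixture_fokker_planck _ _ mu _ _ _ _ _ Da Ds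
    (alpha0 t t01) (sigma0 t t01)) => //.
  - by rewrite /f_coef derive1E.
  (* Nonnegativity of [g2_coef] lets the square undo the root; then $\frac{d}{dt}\sigma^2 =
     2\sigma\dot\sigma$. *)
  rewrite /g_coef sqr_sqrtr ?g2_ge0// /g2_coef !derive1E.
  have D2 := is_derive_fX 2 Ds.
  by rewrite (@derive_val _ _ _ _ _ _ _ D2) /= expr1; ring.
split; last first.
  by move=> t x t01; have [_ _ _ _] := FP t x t01.
split; last exact: FP.
- move=> t t01; rewrite (_ : marginal_pdf _ _ _ _ = fun x =>
    \int[mu]_y gaussian_pdf (alpha t *: y) (sigma t) x); last first.
    by apply/funext => x; exact: pE.
  by apply: gaussian_mixture_density; exact: sigma0.
- apply: (gaussian_mixture_initial_law _ _ mu alpha sigma) => //.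
  + by have := differentiable_on01_cvg0 _ _ dalpha; rewrite a0.
  + by have := differentiable_on01_cvg0 _ _ dsigma; rewrite s0.
Qed.
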